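(* In the reinforcement-learning network model described in the context, let $\mathcal{G}$ be a subgraph of $G$ satisfying $P_{\mathcal{G}}$, fix $q\in\Gamma_{\mathcal{G}}$ (so $q\in\Delta\setminus\partial\Delta$, $G_q=\mathcal{G}$ and $q$ is a stable equilibrium), and let $\mathcal{N}(q)$ be a neighbourhood of $q$ in $\Gamma_{\mathcal{G}}$. Then with positive probability: (1) $x_n\to x$ for some $x\in\mathcal{N}(q)$, which is thus a stable equilibrium with $G_x=\mathcal{G}$; and (2) for all $i,j\in\mathbb{V}$, $V^\infty_{ij}=\infty$ if and only if $\{i,j\}$ is an edge of $\mathcal{G}$, where $V^\infty_{ij}=\lim_n V^n_{ij}$.
   Context: Let $G=(\mathbb{V},E)$ be a finite graph with adjacency $\sim$ and edge set $E$. Let $a_{ij}=a_{ji}\ge0$ with $a_{ij}>0$ only if $i\sim j$. Let $(p_W)_{W\subseteq\mathbb{V}}$ be nonnegative with $\sum_Wp_W=1$; for $i\sim j$, $p_{ij}=\sum_{W:i,j\in W}p_W$; $p_{ij}=0$ if $i\not\sim j$. Assume some $a_{ij}p_{ij}>0$. Let $v^0_{ij}=v^0_{ji}\ge0$, $>0$ iff $i\sim j$. Process: $V^0_{ij}=v^0_{ij}$, $V^n_{ij}=0$ if $i\not\sim j$, $V^n_i=\sum_jV^n_{ij}$; at each time $n$ each vertex $i$ independently chooses a neighbour $j$ with probability $V^n_{ij}/V^n_i$; independently Nature picks $W_n$ with $\mathbb{P}(W_n=W)=p_W$, i.i.d.; if $i,j\in W_n$, $i\sim j$, and $i,j$ choose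 each other, then $V^{n+1}_{ij}=V^{n+1}_{ji}=V^n_{ij}+a_{ij}$, else unchanged. Let $T_n=\sum_{i,j}V^n_{ij}$ (ordered pairs), $x^n_{ij}=V^n_{ij}/T_n$, $x_n=(x^n_{ij})$. Let $h_1=\sum_{(i,j):a_{ij}p_{ij}>0}v^0_{ij}/\sum_{k,l}v^0_{kl}$; $\Delta$ is the set of arrays $x$ with $x_{ij}=x_{ji}\ge0$, $x_{ij}=0$ if $i\not\sim j$, $\sum_{i,j}x_{ij}=1$, $\sum_{(i,j):a_{ij}p_{ij}>0}x_{ij}\ge h_1$; $x_i=\sum_jx_{ij}$. $\partial\Delta$: the $x\in\Delta$ for which some vertex $i$ having a neighbour $j$ with $a_{ij}p_{ij}>0$ has $\sum_{j:a_{ij}p_{ij}>0}x_{ij}=0$. $H(x)=\sum_{(i,j):x_{ij}>0}a_{ij}p_{ij}x_{ij}^2/(x_ix_j)$; $F(x)_{ij}=x_{ij}(y_{ij}-H(x))$ with $y_{ij}=a_{ij}p_{ij}x_{ij}/(x_ix_j)$ ($y_{ij}:=0$ if $a_{ij}p_{ij}=0$; $F_{ij}=0$ if $x_{ij}=0$); $\Gamma=\{x\in\Delta:F(x)=0\}$. For $x\in\Gamma\cap(\Delta\setminus\partial\Delta)$, $J(x)$ is the Jacobian (indexed by pairs of edges) of $(x_e)_{e\in E}\mapsto(F_e(x))_{e\in E}$ with $x_{ij}=x_{ji}=x_e$ for $e=\{i,j\}$, $x_i=\sum_jx_{ij}$, the formulas for $H$ (terms with $a_{ij}p_{ij}>0$)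 and $F$ regarded as smooth functions of unconstrained variables near $x$; $x$ is a stable equilibrium iff $x\in\Gamma\cap(\Delta\setminus\partial\Delta)$ and all eigenvalues of $J(x)$ have nonpositive real part. $G_x$: subgraph with vertex set $\mathbb{V}$, $i,j$ adjacent iff $x_{ij}>0$. For a subgraph $\mathcal{G}$ of $G$ (vertex set $\mathbb{V}$) with components $\mathcal{C}_1,\dots,\mathcal{C}_d$, $P_{\mathcal{G}}$ means: (1) all edges $\{i,j\}$ of $\mathcal{G}$ in a same component have the same value $a_{ij}p_{ij}>0$; (2) each component has at most one vertex with several neighbours; (3) a vertex lies on an edge of $\mathcal{G}$ iff $a_{ij}p_{ij}>0$ for some $j\sim i$. Under $P_{\mathcal{G}}$, the nucleus of a component is its unique vertex with several neighbours (arbitrary one if the component has two vertices; the vertex itself if isolated); $N$ = set of nuclei; $(ap)_i=a_{ik}p_{ik}$ for any $\mathcal{G}$-neighbour $k$ of $i\in N$ ($0$ if isolated). $\Gamma_{\mathcal{G}}$ is the set of $q\in\Delta$ with $G_q=\mathcal{G}$, $q_i=(ap)_i/(2\sum_{j\in N}(ap)_j)$ for $i\in N$, and for $i\in N$ the $q_{ij}$ ($j$ a $\mathcal{G}$-neighbour of $i$) positive with sum $q_i$. *)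

(* Defs.v *)
From HB Require Import structures.
From mathcomp Require Import all_boot all_order all_algebra.
From mathcomp Require Import all_classical all_reals all_analysis.
From mathcomp Require Import complex.
Import Order.TTheory GRing.Theory Num.Theory.
Import numFieldNormedType.Exports.

Set Implicit Arguments.
Unset Strict Implicit.
Unset Printing Implicit Defensive.

Local Open Scope ring_scope.


Section RLNetwork.
Variables (R : realType) (V : finType) (adj : rel V).
Variables (a : V -> V -> R) (pW : {set V} -> R) (v0 : V -> V -> R).

Definition pij (i j : V) : R :=
  if adj i j then \sum_(W : {set V} | (i \in W) && (j \in W)) pW W else 0.

Definition ap (i j : V) : R := a i j * pij i j.

Definition xv (x : V -> V -> R) (i : V) : R := \sum_(j : V) x i j.

Definition h1 : R :=
  (\sum_(i : V) \sum_(j : V | 0 < ap i j) v0 i j) / (\sum_(k : V) \sum_(l : V) v0 k l).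

Definition in_Delta (x : V -> V -> R) : Prop :=
  [/\ forall i j, x i j = x j i,
      forall i j, 0 <= x i j,
      forall i j, ~~ adj i j -> x i j = 0,
      \sum_(i : V) \sum_(j : V) x i j = 1
    & h1 <= \sum_(i : V) \sum_(j : V | 0 < ap i j) x i j].

Definition in_bdry (x : V -> V -> R) : Prop :=
  in_Delta x /\
  exists i : V, (exists j : V, adj i j /\ 0 < ap i j) /\
                \sum_(j : V | 0 < ap i j) x i j = 0.

Definition Hfun (x : V -> V -> R) : R :=
  \sum_(i : V) \sum_(j : V | 0 < x i j) ap i j * x i j ^+ 2 / (xv x i * xv x j).

Definition yfun (x : V -> V -> R) (i j : V) : R :=
  if ap i j == 0 then 0 else ap i j * x i j / (xv x i * xv x j).

Definition Ffun (x : V -> V -> R) (i j : V) : R :=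
  if x i j == 0 then 0 else x i j * (yfun x i j - Hfun x).

Definition in_Gamma (x : V -> V -> R) : Prop :=
  in_Delta x /\ forall i j, Ffun x i j = 0.

(** Smooth versions (used for the Jacobian): H with the terms a_ij p_ij > 0. *)
Definition Hsmooth (x : V -> V -> R) : R :=
  \sum_(i : V) \sum_(j : V | 0 < ap i j) ap i j * x i j ^+ 2 / (xv x i * xv x j).

Definition Fsmooth (x : V -> V -> R) (i j : V) : R :=
  x i j * (yfun x i j - Hsmooth x).

Definition Eset : {set {set V}} :=
  [set e : {set V} | [exists i : V, exists j : V, adj i j && (e == [set i; j])]].

Definition nE : nat := #|Eset|.

Definition ends (k : 'I_#|Eset|) : option (V * V) :=
  let e := enum_val k in
  match [pick i in e] with
  | Some i => match [pick j in e :\ i] with Some j => Some (i, j) | None => None end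
  | None => None
  end.

(** the array x with x_ij = x_ji = y_e for e = {i, j} an edge (0 off edges) *)
Definition arr_of (y : 'rV[R]_#|Eset|) : V -> V -> R :=
  fun i j => \sum_(k < #|Eset| | enum_val k == [set i; j]) y 0 k.

Definition edge_coords (x : V -> V -> R) : 'rV[R]_#|Eset| :=
  \row_(k < #|Eset|) (match ends k with Some (i, j) => x i j | None => 0 end).

Definition Fedge (y : 'rV[R]_#|Eset|) (k : 'I_#|Eset|) : R :=
  match ends k with Some (i, j) => Fsmooth (arr_of y) i j | None => 0 end.

Definition Jac (x : V -> V -> R) : 'M[R]_#|Eset| :=
  \matrix_(k, l) derive (fun y : 'rV[R]_#|Eset| => Fedge y k) (edge_coords x)
                        (delta_mx 0 l).

Definition stable_eq (x : V -> V -> R) : Prop :=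
  [/\ in_Gamma x, ~ in_bdry x &
      forall z : R[i], root (map_poly (real_complex R) (char_poly (Jac x))) z ->
                       complex.Re z <= 0].

Definition Gx (x : V -> V -> R) : rel V := fun i j => 0 < x i j.

Definition nbrs (g : rel V) (i : V) : {set V} := [set j | g i j].

Definition P_G (g : rel V) : Prop :=
  [/\ (forall i j k l, g i j -> g k l -> connect g i k -> 0 < ap i j /\ ap i j = ap k l),
      (forall i k, connect g i k -> (1 < #|nbrs g i|)%N -> (1 < #|nbrs g k|)%N -> i = k)
    & (forall i, (exists j, g i j) <-> (exists j, adj i j /\ 0 < ap i j))].

Definition nuclei (g : rel V) (N : {set V}) : Prop :=
  [/\ (forall i, exists2 k, k \in N & connect g i k),
      (forall k l, k \in N -> l \in N -> connect g k l -> k = l)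
    & (forall k i, k \in N -> connect g k i -> (1 < #|nbrs g i|)%N -> i = k)].

Definition apN (g : rel V) (i : V) : R :=
  match [pick k | g i k] with Some k => ap i k | None => 0 end.

Definition in_Gamma_G (g : rel V) (q : V -> V -> R) : Prop :=
  [/\ in_Delta q, (forall i j, Gx q i j = g i j) &
      exists N : {set V}, nuclei g N /\
        forall i, i \in N ->
          [/\ xv q i = apN g i / (2 * \sum_(j in N) apN g j),
              (forall j, g i j -> 0 < q i j)
            & \sum_(j | g i j) q i j = xv q i]].

(** the process: one time step = (choices of all vertices, set W_n) *)
Definition step := ({ffun V -> V} * {set V})%type.

Definition rewarded (s : step) (i j : V) : bool :=
  [&& i \in s.2, j \in s.2, adj i j, s.1 i == j & s.1 j == i].

Fixpoint Vproc (h : nat -> step) (n : nat) : V -> V -> R :=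
  match n with
  | 0 => v0
  | n'.+1 => fun i j => Vproc h n' i j + (if rewarded (h n') i j then a i j else 0)
  end.

Definition Tproc (h : nat -> step) (n : nat) : R := \sum_(i : V) \sum_(j : V) Vproc h n i j.

Definition xproc (h : nat -> step) (n : nat) : V -> V -> R :=
  fun i j => Vproc h n i j / Tproc h n.

(** probability that vertex i chooses j given weights Vk (convention: a vertex
    with no neighbour "chooses" itself) *)
Definition choice_prob (Vk : V -> V -> R) (i j : V) : R :=
  if xv Vk i == 0 then (j == i)%:R else Vk i j / xv Vk i.

Definition step_prob (Vk : V -> V -> R) (s : step) : R :=
  (\prod_(i : V) choice_prob Vk i (s.1 i)) * pW s.2.

End RLNetwork.

(* Main.v *)
(* Every edge of the subgraph joins the nucleus c of a star to a leaf l having no other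
   neighbour in the subgraph.  Write S_c for the total weight of the star and Z_cl for the
   share of the edge in S_c.  When the weights off the subgraph stay bounded and S_c ~ n, the
   mean increment of V_cl is (ap)_c Z_cl (1 - O(1/n)): hence S_c grows at the constant rate
   (ap)_c, and Z_cl is a bounded martingale up to O(1/n^2), with increments O(1/n).  An edge
   off the subgraph is reinforced with probability O(1/n^2), since both of its ends have to
   choose an edge of bounded weight.

   All this is encoded in one nonnegative function Phi of the past, a supermartingale as long
   as Phi < 1 and only edges of the subgraph have been reinforced.  If Phi < 1 at some time,
   then with positive probability this remains so forever, and on that event, by a
   deterministic argument, S_c / n converges and Z_cl is Cauchy and stays close to its target.
   A state with Phi < 1 is reached with positive probability by a greedy control: every
   nucleus chooses a leaf whose share is below its target.

   For the stability, in the Jacobian the row of an edge off the subgraph is -H times a unit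
   vector, and the block of each star is -H times a rank-one projection. *)

Require Import Defs.
From HB Require Import structures.
From mathcomp Require Import all_boot all_order all_algebra.
From mathcomp Require Import all_classical all_reals all_analysis.
From mathcomp Require Import complex.
From mathcomp Require Import ring lra.
Import Order.TTheory GRing.Theory Num.Theory.
Import numFieldNormedType.Exports.
Set Implicit Arguments.
Unset Strict Implicit.
Unset Printing Implicit Defensive.
Local Open Scope ring_scope.
Local Open Scope classical_set_scope.

(** * Supermartingales on cylinders *)

(** The obstacle is the convergence of the shares Z_cl: a potential measuring their distance to the
    target confines them but does not make them converge. Hence [Phi] also compares each share with
    its value at a time when the clock was a power 16^k, with weight 4^k. Then [Phi] < 1 bounds the
    oscillation on that block by 2^-k, which is summable, so that convergence holds on every path of
    the event. The weight 4^k is at most the square root of the clock m, so the O(1/m^2) errors in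
    the squared shares cost O(m^(-3/2)). The squared deviation of S_c from linear growth, divided by
    m^(3/2), costs as much, and an escape along another edge costs O(1/m^2). All this is summable
    and is prepaid by the single term [Kphi] / sqrt m, which makes [Phi] a supermartingale. The law
    of the process enters only through the probabilities of cylinders. *)

Section Survival.
Variables (R : realType) (S : finType).
Variables (d : measure_display) (T : measurableType d) (P : probability T R).
Variables (X : nat -> T -> S) (w : nat -> (nat -> S) -> S -> R).

(** The path is continued by the constant [s]; only its values up to time [n] matter, since
    everything below depends on the past alone. *)
Definition upd (h : nat -> S) (n : nat) (s : S) : nat -> S :=
  fun k => if (k < n)%N then h k else s.

Definition agree (n : nat) (h h' : nat -> S) : Prop :=
  forall k, (k < n)%N -> h k = h' k.

Definition cyl (n : nat) (h : nat -> S) : set T :=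
  [set t | forall k, (k < n)%N -> X k t = h k].

Definition path_prob (n : nat) (h : nat -> S) : R := \prod_(k < n) w k h (h k).

Hypothesis w_local : forall n h h', agree n h h' -> forall s, w n h s = w n h' s.
Hypothesis X_meas : forall n h, measurable (cyl n h).
Hypothesis X_law : forall n h, P (cyl n h) = (path_prob n h)%:E.

Lemma upd_agree h n s : agree n h (upd h n s).
Proof. by move=> k kn; rewrite /upd kn. Qed.

Lemma path_prob_upd n h s : path_prob n.+1 (upd h n s) = path_prob n h * w n h s.
Proof.
rewrite /path_prob big_ord_recr /= /upd ltnn; congr (_ * _); last first.
  by apply: w_local => k kn; rewrite kn.
apply: eq_bigr => k _; rewrite ltn_ord; apply: w_local => l lk.
by rewrite (ltn_trans lk (ltn_ord k)).
Qed.

Lemma cylS n h (B : set T) :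
  cyl n h `&` B = \bigcup_(s in [set: S]) (cyl n.+1 (upd h n s) `&` B).
Proof.
apply/seteqP; split => t /=.
  move=> [ch Bt]; exists (X n t) => //; split => // k.
  rewrite ltnS leq_eqVlt /upd => /orP[/eqP ->|kn]; first by rewrite ltnn.
  by rewrite kn ch.
move=> [s _ [ch Bt]]; split => // k kn.
by rewrite ch ?(ltn_trans kn) // /upd kn.
Qed.

(** After j splittings by [cylS] the property is constant on each piece, so the event is a finite
    union of cylinders. *)
Lemma measurable_cyl_local j n h (Q : (nat -> S) -> Prop) :
  (forall h1 h2, agree (n + j) h1 h2 -> Q h1 -> Q h2) ->
  measurable (cyl n h `&` [set t | Q (fun k => X k t)]).
Proof.
elim: j n h => [|j IH] n h Qloc.
  have [Qh|nQ] := pselect (Q h).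
    rewrite (_ : _ `&` _ = cyl n h); first exact: X_meas.
    apply/seteqP; split=> [t []//|t ct]; split => //=.
    by apply: Qloc Qh => k; rewrite addn0 => kn; rewrite ct.
  rewrite (_ : _ `&` _ = set0); first exact: measurable0.
  apply/seteqP; split=> // t [/= ct Qt]; apply: nQ.
  by apply: Qloc Qt => k; rewrite addn0 => kn; rewrite ct.
rewrite cylS; apply: fin_bigcup_measurable => // s _.
by apply: IH; rewrite addSnnS.
Qed.

Lemma measure_fin_bigcup_le (B : S -> set T) (b : S -> R) :
  (forall s, measurable (B s)) -> (forall s, (P (B s) <= (b s)%:E)%E) ->
  (P (\bigcup_(s in [set: S]) B s) <= (\sum_s b s)%:E)%E.
Proof.
move=> mB Bb.
have -> : [set: S] = [set` index_enum S].
  by apply/seteqP; split => // s _ /=; rewrite mem_index_enum.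
rewrite bigcup_seq.
suff [] : measurable (\big[setU/set0]_(s <- index_enum S) B s) /\
  (P (\big[setU/set0]_(s <- index_enum S) B s) <=
    (\sum_(s <- index_enum S) b s)%:E)%E by [].
elim: (index_enum S) => [|s r [mr IH]].
  by rewrite !big_nil measure0; split.
rewrite !big_cons; split; first exact: measurableU.
rewrite EFinD; apply: (le_trans (measureU2 _ _ _)); [exact: mB|exact: mr|].
by apply: leeD; [exact: Bb|exact: IH].
Qed.

Variables (n0 : nat) (G : nat -> (nat -> S) -> Prop) (Phi : nat -> (nat -> S) -> R).
Hypothesis w_ge0 : forall n h, G n h -> forall s, 0 <= w n h s.
Hypothesis G_local : forall n h1 h2, agree n h1 h2 -> G n h1 -> G n h2.
Hypothesis G_anti : forall n h, G n.+1 h -> G n h.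
Hypothesis Phi_ge0 : forall n h, G n h -> 0 <= Phi n h.
Hypothesis Phi_step : forall n h, (n0 <= n)%N -> G n h ->
  \sum_s w n h s * (if `[< G n.+1 (upd h n s) >] then Phi n.+1 (upd h n s) else 1)
    <= Phi n h.

Let bad n := [set t | ~ G n (fun k => X k t)].

Lemma measurable_cyl_bad j n h : measurable (cyl n h `&` bad (n + j)).
Proof.
apply: (@measurable_cyl_local j n h (fun h => ~ G (n + j) h)) => h1 h2 h12 nG G2.
by apply: nG; apply: G_local G2 => k kn; rewrite h12.
Qed.

(** Induction on the remaining time j. The cylinder is split by the next step: a piece outside [G]
    costs its full probability, a piece inside is handled by induction, and [Phi_step] adds up the
    costs. *)
Lemma bad_prob_le j n h : (n0 <= n)%N -> G n h -> 0 <= path_prob n h ->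
  (P (cyl n h `&` bad (n + j)) <= (path_prob n h * Phi n h)%:E)%E.
Proof.
elim: j n h => [|j IH] n h n0n Gh p0.
  rewrite (_ : _ `&` _ = set0) ?measure0 ?lee_fin ?mulr_ge0 ?Phi_ge0 //.
  apply/seteqP; split=> // t [/= ct]; apply; rewrite addn0.
  by apply: G_local Gh => k kn; rewrite ct.
rewrite cylS.
apply: le_trans (measure_fin_bigcup_le (b := fun s => path_prob n h * (w n h s *
   (if `[< G n.+1 (upd h n s) >] then Phi n.+1 (upd h n s) else 1))) _ _) _.
- by move=> s; rewrite -addSnnS; exact: measurable_cyl_bad.
- move=> s; rewrite -addSnnS mulrA -path_prob_upd.
  have p1 : 0 <= path_prob n.+1 (upd h n s).
    by rewrite path_prob_upd mulr_ge0 // w_ge0.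
  case: asboolP => [G1|_]; first by apply: IH => //; exact: leq_trans n0n _.
  rewrite mulr1 -X_law; apply: le_measure; rewrite ?inE //.
  exact: measurable_cyl_bad.
- by rewrite -mulr_sumr lee_fin ler_wpM2l // Phi_step.
Qed.

(* Doob's maximal inequality: Phi, stopped at 1 when G fails, is a supermartingale, so that
   the probability that G ever fails is at most the initial value of Phi. *)
Theorem survival (h0 : nat -> S) :
  G n0 h0 -> 0 < path_prob n0 h0 -> Phi n0 h0 < 1 ->
  let A := cyl n0 h0 `&` [set t | forall n, G n (fun k => X k t)] in
  measurable A /\ (0 < P A)%E.
Proof.
move=> Gh p0 Phi1 A.
pose F j := cyl n0 h0 `&` bad (n0 + j).
have mF j : measurable (F j) by exact: measurable_cyl_bad.
have mUF : measurable (\bigcup_j F j) by exact: bigcup_measurable.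
have Gle n m h : (n <= m)%N -> G m h -> G n h.
  move=> /subnK <-; elim: (m - n)%N => //= k IH /G_anti; exact: IH.
have AE : A = cyl n0 h0 `\` \bigcup_j F j.
  apply/seteqP; split => t /=.
    by move=> [ct Gt]; split => // -[j _ [_ /=]]; apply.
  move=> [ct nF]; split => // n; apply: contrapT => nG; apply: nF.
  by exists n => //; split => //= /(Gle n); rewrite leq_addl => /(_ isT).
have mA : measurable A by rewrite AE; apply: measurableD.
split=> //.
have Fle : (P (\bigcup_j F j) <= (path_prob n0 h0 * Phi n0 h0)%:E)%E.
  have cF : (P \o F) x @[x --> \oo] --> P (\bigcup_j F j).
    apply: nondecreasing_cvg_mu => // j k jk; apply/subsetPset => t [ct bt].
    by split => // Gk; apply: bt; apply: Gle Gk; rewrite leq_add2l.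
  rewrite -(cvg_lim _ cF) //; apply: lime_le; first by apply/cvg_ex; eexists; exact: cF.
  by near=> j; apply: bad_prob_le => //; exact: ltW.
have UC : \bigcup_j F j `<=` cyl n0 h0 by move=> t [j _ []].
have PC : P (cyl n0 h0) = (P A + P (\bigcup_j F j))%E.
  rewrite AE -measureU //; first by rewrite setUC setDUK.
    exact: measurableD.
  by rewrite setDE setIAC -setIA setICr setI0.
(* If [A] were null, the cylinder would have at most [Phi] < 1 times its own positive
   probability. *)
rewrite ltNge; apply/negP => PA0.
have : (P (cyl n0 h0) <= (path_prob n0 h0 * Phi n0 h0)%:E)%E.
  by rewrite PC; apply: le_trans Fle; rewrite -[leRHS]add0e leeD2r.
by rewrite X_law lee_fin leNgt gtr_pMr // Phi1.
Unshelve. all: by end_near.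
Qed.

End Survival.
(** * One step of the process *)

Section OneStep.
Variables (R : realType) (V : finType) (adj : rel V) (a : V -> V -> R) (pW : {set V} -> R).
Hypothesis adj_irr : irreflexive adj.
Hypothesis adj_sym : symmetric adj.
Hypothesis a_ge0 : forall i j, 0 <= a i j.
Hypothesis pW_ge0 : forall W, 0 <= pW W.
Hypothesis pW_sum : \sum_(W : {set V}) pW W = 1.

Notation pij := (pij adj pW).
Notation ap := (ap adj a pW).

(** Conditional expectation of a function of the next step, given the current weights [Vk]. *)
Definition mean (Vk : V -> V -> R) (f : step V -> R) : R :=
  \sum_s step_prob pW Vk s * f s.

Definition gain (s : step V) (i j : V) : R := if rewarded adj s i j then a i j else 0.

Definition next (Vk : V -> V -> R) (s : step V) : V -> V -> R :=
  fun i j => Vk i j + gain s i j.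

Lemma gain_ge0 s i j : 0 <= gain s i j.
Proof. by rewrite /gain; case: ifP. Qed.

Lemma gain_le s i j : gain s i j <= a i j.
Proof. by rewrite /gain; case: ifP. Qed.

Lemma rewarded_sym s i j : rewarded adj s i j = rewarded adj s j i.
Proof. by rewrite /rewarded adj_sym; do !case: (_ \in _); do !case: (_ == _); case: (adj _ _). Qed.

Lemma choice_prob_ge0 (Vk : V -> V -> R) i j :
  (forall i j, 0 <= Vk i j) -> 0 <= choice_prob Vk i j.
Proof.
move=> V0; rewrite /choice_prob; case: ifP => _; first exact: ler0n.
by apply: divr_ge0 => //; apply: sumr_ge0 => k _; exact: V0.
Qed.

Lemma choice_prob_sum (Vk : V -> V -> R) i : \sum_j choice_prob Vk i j = 1.
Proof.
rewrite /choice_prob; have [xv0|xv0] := eqVneq (xv Vk i) 0; last by rewrite -mulr_suml divff.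
by rewrite (bigD1 i) //= eqxx big1 ?addr0 // => j /negPf ->.
Qed.

Lemma step_prob_ge0 (Vk : V -> V -> R) s :
  (forall i j, 0 <= Vk i j) -> 0 <= step_prob pW Vk s.
Proof. by move=> V0; rewrite mulr_ge0 // prodr_ge0 // => i _; exact: choice_prob_ge0. Qed.

(** Independence of the choices of the vertices and of Nature: the product of sums expands into a
    sum over choice functions. *)
Lemma mean_prod (Vk : V -> V -> R) (f : V -> V -> R) (u : {set V} -> R) :
  mean Vk (fun s => (\prod_i f i (s.1 i)) * u s.2) =
  (\prod_i \sum_j choice_prob Vk i j * f i j) * \sum_W pW W * u W.
Proof.
rewrite bigA_distr_bigA /mean mulr_suml.
rewrite -(pair_bigA _ (fun (c : {ffun V -> V}) W =>
  step_prob pW Vk (c, W) * ((\prod_i f i (c i)) * u W))) /=.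
apply: eq_bigr => c _; rewrite mulr_sumr; apply: eq_bigr => W _.
by rewrite /step_prob /= big_split /= mulrACA.
Qed.

Lemma mean1 (Vk : V -> V -> R) : mean Vk (fun=> 1) = 1.
Proof.
transitivity (mean Vk (fun s => (\prod_(i : V) 1) * 1)).
  by rewrite /mean; apply: eq_bigr => s _; rewrite big1 ?mulr1.
rewrite (mean_prod Vk (fun _ _ => 1) (fun=> 1)).
under [X in _ * X]eq_bigr do rewrite mulr1.
rewrite pW_sum mulr1 big1 // => i _.
by under eq_bigr do rewrite mulr1; exact: choice_prob_sum.
Qed.

Lemma mean_rewarded (Vk : V -> V -> R) i j : adj i j ->
  mean Vk (fun s => (rewarded adj s i j)%:R) =
  pij i j * (choice_prob Vk i j * choice_prob Vk j i).
Proof.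
move=> ij; have nij : i != j by apply: contraTneq ij => ->; rewrite adj_irr.
have nji : j != i by rewrite eq_sym.
(* The event that i and j choose each other, as a product over all vertices; the factor is 1 at
   every vertex other than i and j. *)
pose f k v : R := (((k == i) ==> (v == j)) && ((k == j) ==> (v == i)))%:R.
transitivity (mean Vk (fun s => (\prod_k f k (s.1 k)) *
     ((i \in s.2) && (j \in s.2))%:R)).
  rewrite /mean; apply: eq_bigr => s _; congr (_ * _).
  rewrite (bigD1 i) // (bigD1 j) //= big1 => [|k /andP[/negPf ki /negPf kj]]; last first.
    by rewrite /f ki kj.
  rewrite /f !eqxx (negPf nij) (negPf nji) /= andbT mulr1 -!natrM !mulnb.
  congr (_%:R); rewrite /rewarded ij /=.
  by do !case: (_ \in _); do !case: (_ == _).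
rewrite (mean_prod Vk f (fun W => ((i \in W) && (j \in W))%:R)) mulrC /pij ij.
congr (_ * _).
  rewrite [RHS]big_mkcond; apply: eq_bigr => W _.
  by case: ifP; rewrite ?mulr1 ?mulr0.
rewrite (bigD1 i) // (bigD1 j) //= [X in _ * (_ * X)]big1 => [|k /andP[/negPf ki /negPf kj]]; last first.
  rewrite /f ki kj /=; under eq_bigr do rewrite mulr1; exact: choice_prob_sum.
rewrite mulr1; congr (_ * _).
  rewrite (bigD1 j) //= /f !eqxx (negPf nij) /= mulr1 big1 ?addr0 // => k /negPf ->.
  by rewrite mulr0.
rewrite (bigD1 i) //= /f !eqxx (negPf nji) /= mulr1 big1 ?addr0 // => k /negPf ->.
by rewrite mulr0.
Qed.

Lemma mean_le (Vk : V -> V -> R) f1 f2 : (forall i j, 0 <= Vk i j) ->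
  (forall s, f1 s <= f2 s) -> mean Vk f1 <= mean Vk f2.
Proof. by move=> V0 f12; apply: ler_sum => s _; rewrite ler_wpM2l ?step_prob_ge0. Qed.

Lemma mean_sum (Vk : V -> V -> R) (I : finType) (Q : pred I) (f : I -> step V -> R) :
  mean Vk (fun s => \sum_(i | Q i) f i s) = \sum_(i | Q i) mean Vk (f i).
Proof.
rewrite /mean exchange_big /=; apply: eq_bigr => s _; by rewrite mulr_sumr.
Qed.

Lemma mean_lin (Vk : V -> V -> R) (k0 k1 k2 : R) f1 f2 :
  mean Vk (fun s => k0 + k1 * f1 s + k2 * f2 s) =
  k0 + k1 * mean Vk f1 + k2 * mean Vk f2.
Proof.
rewrite -[k0 in RHS]mulr1 -(mean1 Vk) /mean !mulr_sumr -!big_split /=.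
by apply: eq_bigr => s _; ring.
Qed.

Lemma meanD (Vk : V -> V -> R) f1 f2 :
  mean Vk (fun s => f1 s + f2 s) = mean Vk f1 + mean Vk f2.
Proof. by rewrite /mean -big_split; apply: eq_bigr => s _; rewrite mulrDr. Qed.

Lemma meanZ (Vk : V -> V -> R) k f : mean Vk (fun s => k * f s) = k * mean Vk f.
Proof. by rewrite /mean mulr_sumr; apply: eq_bigr => s _; rewrite mulrCA. Qed.

Lemma mean_cst (Vk : V -> V -> R) k : mean Vk (fun=> k) = k.
Proof. by rewrite -[RHS]mulr1 -(mean1 Vk) -meanZ; under [RHS]eq_bigr do rewrite mulr1. Qed.

Lemma mean_gain (Vk : V -> V -> R) i j :
  mean Vk (fun s => gain s i j) = ap i j * (choice_prob Vk i j * choice_prob Vk j i).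
Proof.
case ij : (adj i j); last first.
  rewrite /Defs.ap /Defs.pij ij mulr0 mul0r /mean big1 // => s _.
  by rewrite /gain /rewarded ij !andbF mulr0.
rewrite /Defs.ap -mulrA -mean_rewarded // /mean mulr_sumr.
by apply: eq_bigr => s _; rewrite /gain; case: ifP => _; rewrite ?mulr1 ?mulr0 // mulrC.
Qed.

(** * One star: mean increments of its weight and of its shares *)

Section Star.
Variables (Vk : V -> V -> R) (B A : R) (g : rel V) (c : V).
Hypothesis V_ge0 : forall i j, 0 <= Vk i j.
Hypothesis V_sym : forall i j, Vk i j = Vk j i.
Hypothesis B_ge0 : 0 <= B.
Hypothesis A_ge0 : 0 <= A.
Hypothesis g_pos : forall k, g c k -> 0 < Vk c k.
Hypothesis g_ap : forall k, g c k -> ap c k = A.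
Hypothesis leaf_le : forall k, g c k -> xv Vk k <= Vk c k + B.

(** This is S_c, and [ratio] below is Z_cl. *)
Definition hub (U : V -> V -> R) : R := \sum_(k | g c k) U c k.
Definition ratio (U : V -> V -> R) (l : V) : R := U c l / hub U.
Definition hub_gain (s : step V) : R := \sum_(k | g c k) gain s c k.

Hypothesis hub_le : xv Vk c <= hub Vk + B.

Let S := hub Vk.
Let Kg := \sum_i \sum_j a i j.

Lemma hub_next s : hub (next Vk s) = S + hub_gain s.
Proof. by rewrite /hub big_split. Qed.

Lemma hub_gain_ge0 s : 0 <= hub_gain s.
Proof. by apply: sumr_ge0 => k _; exact: gain_ge0. Qed.

Lemma gain_le_hub s l : g c l -> gain s c l <= hub_gain s.
Proof.
by move=> gl; rewrite /hub_gain (bigD1 l) //= lerDl sumr_ge0 // => k _; exact: gain_ge0.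
Qed.

Lemma hub_gain_le s : hub_gain s <= Kg.
Proof.
apply: (@le_trans _ _ (\sum_j a c j)).
  rewrite [leRHS](bigID (g c)) /= -[leLHS]addr0 lerD ?sumr_ge0 //.
  by apply: ler_sum => k _; exact: gain_le.
by rewrite /Kg [leRHS](bigD1 c) //= lerDl sumr_ge0 // => i _; apply: sumr_ge0.
Qed.

Lemma edge_le_hub l : g c l -> Vk c l <= S.
Proof. by move=> gl; rewrite /S /hub (bigD1 l) //= lerDl sumr_ge0. Qed.

Lemma hub_le_xv : S <= xv Vk c.
Proof. by rewrite /xv (bigID (g c)) /= lerDl sumr_ge0. Qed.

(* The loss comes from the weight, at most B, that c and l put outside the star. *)
Lemma mean_gain_bounds l : g c l ->
  0 <= A * (Vk c l / S) - mean Vk (fun s => gain s c l) <= 2 * A * B / S.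
Proof.
move=> gl; rewrite mean_gain g_ap //.
have v0 := g_pos gl; have vS := edge_le_hub gl.
have S0 : 0 < S by exact: lt_le_trans vS.
have xc : S <= xv Vk c := hub_le_xv.
have xl : Vk c l <= xv Vk l by rewrite V_sym /xv (bigD1 c) //= lerDl sumr_ge0.
have hc := hub_le; have hl := leaf_le gl; rewrite -/S in hc.
rewrite /choice_prob (gt_eqF (lt_le_trans S0 xc)) (gt_eqF (lt_le_trans v0 xl)) (V_sym l c).
move: (xv Vk c) (xv Vk l) (Vk c l) S xc xl hc hl v0 vS S0 => X Y v t Xt Yv XB YB v0 vt t0.
have X0 : 0 < X by exact: lt_le_trans Xt.
have Y0 : 0 < Y by exact: lt_le_trans Yv.
have -> : A * (v / t) - A * (v / X * (v / Y)) = A * (v * (X * Y - t * v) / (t * X * Y)).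
  by field; rewrite !gt_eqF.
have -> : 2 * A * B / t = A * (2 * B / t) by ring.
apply/andP; split.
  apply: mulr_ge0 => //; apply: divr_ge0; last by rewrite !mulr_ge0 // ltW.
  by apply: mulr_ge0; rewrite ?(ltW v0) // subr_ge0 ler_pM // ltW.
rewrite ler_wpM2l // ler_pdivrMr ?mulr_gt0 //.
have -> : 2 * B / t * (t * X * Y) = 2 * B * X * Y by field; rewrite gt_eqF.
(* X - t and Y - v are the weights of the nucleus and of the leaf outside the star, each at most B;
   this is the origin of the factor 2. *)
have h1 : v * (X * Y - t * v) = v * (X - t) * Y + v * t * (Y - v) by ring.
have h2 : v * (X - t) * Y <= X * B * Y.
  by rewrite ler_wpM2r ?(ltW Y0) // ler_pM ?(ltW v0) ?subr_ge0 //; lra.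
have h3 : v * t * (Y - v) <= Y * X * B.
  by rewrite ler_pM ?mulr_ge0 ?(ltW v0) ?subr_ge0 ?(ltW t0) //; [rewrite ler_pM ?(ltW v0) ?(ltW t0)|lra].
rewrite h1; apply: (le_trans (lerD h2 h3)); rewrite le_eqVlt; apply/orP; left; apply/eqP; ring.
Qed.

Let C1 := #|V|%:R * (2 * A * B).

Lemma ratio_sum : 0 < S -> \sum_(k | g c k) Vk c k / S = 1.
Proof. by move=> S0; rewrite -mulr_suml divff ?gt_eqF. Qed.

Lemma mean_hub_gain_bounds : 0 < S ->
  0 <= A - mean Vk hub_gain <= C1 / S.
Proof.
move=> S0; rewrite /hub_gain mean_sum -[A in A - _]mulr1 -(ratio_sum S0) mulr_sumr -sumrB.
apply/andP; split; first by apply: sumr_ge0 => k gk; case/andP: (mean_gain_bounds gk).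
apply: (@le_trans _ _ (\sum_(k | g c k) 2 * A * B / S)).
  by apply: ler_sum => k gk; case/andP: (mean_gain_bounds gk).
rewrite big_mkcond /=; apply: (@le_trans _ _ (\sum_(k : V) 2 * A * B / S)).
  by apply: ler_sum => k _; case: ifP => // _; rewrite divr_ge0 ?mulr_ge0 ?(ltW S0) //.
by rewrite sumr_const -[leLHS]mulr_natl /C1 mulrA.
Qed.

(** In the cross term 2 D (gain - A) the bias of the gain is at most C1 / S while D is at most M S,
    so its mean is bounded by a constant. The square of gain - A is bounded by (A + Kg)^2, which
    leaves a majorant affine in the gain. *)
Lemma hub_drift (D M : R) : 0 < S -> `|D| <= M * S -> 0 <= M ->
  mean Vk (fun s => (D + hub_gain s - A) ^+ 2) <= D ^+ 2 + (2 * M * C1 + (A + Kg) ^+ 2).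
Proof.
move=> S0 DM M0; have /andP[e0 e1] := mean_hub_gain_bounds S0.
apply: (@le_trans _ _ (mean Vk (fun s =>
   (D ^+ 2 - 2 * D * A + (A + Kg) ^+ 2) + (2 * D) * hub_gain s + 0 * hub_gain s))).
  apply: mean_le => // s; have d0 := hub_gain_ge0 s; have d1 := hub_gain_le s.
  rewrite -subr_ge0.
  have -> : D ^+ 2 - 2 * D * A + (A + Kg) ^+ 2 + 2 * D * hub_gain s + 0 * hub_gain s
     - (D + hub_gain s - A) ^+ 2 = (Kg + hub_gain s) * (2 * A + (Kg - hub_gain s)) by ring.
  by apply: mulr_ge0; have := A_ge0; lra.
rewrite mean_lin.
have : - (2 * D) * (A - mean Vk hub_gain) <= 2 * M * C1.
  apply: (@le_trans _ _ (2 * `|D| * (A - mean Vk hub_gain))).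
    by apply: ler_wpM2r => //; have := ler_norm (- D); rewrite normrN; lra.
  apply: (@le_trans _ _ (2 * (M * S) * (C1 / S))).
    by apply: ler_pM => //; rewrite ?mulr_ge0 // ler_wpM2l.
  by rewrite le_eqVlt; apply/orP; left; apply/eqP; field; rewrite gt_eqF.
lra.
Qed.

(** With u the gain of the star, v that of the edge and r = v - Z u, the new share is Z + r / (S +
    u). Replacing it by Z + r / S costs 2 (Kg / S)^2 in the cross term, and the square of the
    increment costs (Kg / S)^2 more. The mean of r is O(1 / S). As z is arbitrary, the bound serves
    both for the target and for a past value of the share. *)
Lemma ratio_drift l (z : R) : 0 < S -> g c l -> 0 <= z <= 1 ->
  mean Vk (fun s => (ratio (next Vk s) l - z) ^+ 2) <=
  (ratio Vk l - z) ^+ 2 + (2 * C1 + 3 * Kg ^+ 2) / S ^+ 2.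
Proof.
move=> S0 gl /andP[z0 z1].
have /andP[e0 e1] := mean_hub_gain_bounds S0.
have /andP[f0 f1] := mean_gain_bounds gl.
set Z := ratio Vk l.
have Z0 : 0 <= Z by rewrite /Z /ratio divr_ge0 // ltW.
have Z1 : Z <= 1 by rewrite /Z /ratio ler_pdivrMr // mul1r edge_le_hub.
have zZ : `|Z - z| <= 1 by rewrite ler_norml; lra.
have Kg0 : 0 <= Kg by apply: sumr_ge0 => i _; apply: sumr_ge0.
apply: (@le_trans _ _ (mean Vk (fun s =>
   ((Z - z) ^+ 2 + 3 * Kg ^+ 2 / S ^+ 2) + (2 * (Z - z) / S) * gain s c l
     + (- (2 * (Z - z) * Z / S)) * hub_gain s))).
  apply: mean_le => // s; have d0 := hub_gain_ge0 s; have d1 := hub_gain_le s.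
  have k0 := gain_ge0 s c l; have k1 := gain_le_hub s gl.
  rewrite /ratio hub_next /next.
  have -> : Vk c l = Z * S by rewrite /Z /ratio -mulrA mulVf ?mulr1 // gt_eqF.
  move: (hub_gain s) (gain s c l) d0 d1 k0 k1 => u v u0 u1 v0 v1.
  have Su : 0 < S + u by lra.
  set r := v - Z * u.
  have rK : `|r| <= Kg.
    have : Z * u <= u by rewrite ler_piMl.
    have : 0 <= Z * u by rewrite mulr_ge0.
    by rewrite ler_norml /r; lra.
  have -> : (Z * S + v) / (S + u) - z = (Z - z) + r / (S + u).
    by rewrite /r; field; rewrite gt_eqF.
  have -> : (Z - z) ^+ 2 + 3 * Kg ^+ 2 / S ^+ 2 + 2 * (Z - z) / S * v +
      - (2 * (Z - z) * Z / S) * u = (Z - z) ^+ 2 + 3 * Kg ^+ 2 / S ^+ 2 + 2 * (Z - z) * (r / S).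
    by rewrite /r; field; rewrite gt_eqF.
  have h1 : `|r / (S + u)| <= Kg / S.
    rewrite normrM normfV (gtr0_norm Su); apply: ler_pM => //.
      by rewrite invr_ge0 ltW.
    by rewrite lef_pV2 ?posrE //; lra.
  have h2 : `|r / (S + u) - r / S| <= (Kg / S) ^+ 2.
    have -> : r / (S + u) - r / S = - (r / (S + u) * (u / S)).
      by field; rewrite !gt_eqF.
    rewrite normrN normrM expr2; apply: ler_pM => //.
    rewrite ger0_norm ?divr_ge0 // ?(ltW S0) //.
    by rewrite ler_wpM2r ?invr_ge0 ?(ltW S0).
  have h3 : (r / (S + u)) ^+ 2 <= (Kg / S) ^+ 2.
    by rewrite -[_ ^+ 2]ger0_norm ?sqr_ge0 // normrX ler_sqr ?nnegrE ?divr_ge0 ?(ltW S0).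
  have h4 : 2 * (Z - z) * (r / (S + u) - r / S) <= 2 * (Kg / S) ^+ 2.
    apply: le_trans (ler_norm _) _; rewrite normrM.
    apply: ler_pM => //; rewrite normrM ger0_norm // -[leRHS]mulr1.
    by rewrite ler_wpM2l.
  move: h3 h4; have -> : 3 * Kg ^+ 2 / S ^+ 2 = 3 * (Kg / S) ^+ 2 by field; rewrite gt_eqF.
  set x := r / (S + u); set y := r / S; set k := (Kg / S) ^+ 2.
  move=> h3 h4; rewrite -subr_ge0.
  by rewrite (_ : _ - _ = (2 * k - 2 * (Z - z) * (x - y)) + (k - x ^+ 2)); [lra|ring].
rewrite mean_lin.
set mu := mean Vk _ in f0 f1 *; set nu := mean Vk _ in e0 e1 *.
have fS : A * (Vk c l / S) = A * Z by [].
rewrite fS in f0 f1.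
have f2 : A * Z - mu <= C1 / S.
  apply: le_trans f1 _; rewrite ler_wpM2r ?invr_ge0 ?(ltW S0) //.
  rewrite /C1 ler_peMl ?mulr_ge0 // ler1n; apply/card_gt0P; by exists c.
(* This is the mean of r. The two errors have opposite signs, so the bound on each is a bound on
   their sum. *)
have h : `|(mu - A * Z) + Z * (A - nu)| <= C1 / S.
  have : Z * (A - nu) <= C1 / S.
    by apply: le_trans e1; rewrite ler_piMl.
  have : 0 <= Z * (A - nu) by rewrite mulr_ge0.
  by rewrite ler_norml; lra.
have -> : (Z - z) ^+ 2 + 3 * Kg ^+ 2 / S ^+ 2 + 2 * (Z - z) / S * mu +
   - (2 * (Z - z) * Z / S) * nu =
   (Z - z) ^+ 2 + 3 * Kg ^+ 2 / S ^+ 2 + 2 / S * ((Z - z) * ((mu - A * Z) + Z * (A - nu))).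
  by field; rewrite gt_eqF.
have -> : (2 * C1 + 3 * Kg ^+ 2) / S ^+ 2 = 3 * Kg ^+ 2 / S ^+ 2 + 2 / S * (C1 / S).
  by field; rewrite gt_eqF.
rewrite addrA lerD2l ler_wpM2l ?divr_ge0 ?(ltW S0) //.
apply: le_trans (ler_norm _) _; rewrite normrM.
by apply: le_trans h; rewrite ler_piMl.
Qed.

End Star.

Lemma mean_escape (Vk : V -> V -> R) (k : R) i j :
  (forall i j, 0 <= Vk i j) -> 0 < k -> k <= xv Vk i -> k <= xv Vk j ->
  mean Vk (fun s => (rewarded adj s i j)%:R) <= pij i j * (Vk i j * Vk j i) / k ^+ 2.
Proof.
move=> V0 k0 ki kj; case ij : (adj i j); last first.
  rewrite /Defs.pij ij !mul0r /mean big1 // => s _.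
  by rewrite /rewarded ij !andbF mulr0.
rewrite mean_rewarded // /choice_prob !gt_eqF; try exact: lt_le_trans k0 _.
rewrite -[leRHS]mulrA ler_wpM2l //; first by rewrite /Defs.pij; case: ifP => // _; apply: sumr_ge0.
rewrite mulrACA ler_wpM2l ?mulr_ge0 // expr2 invfM.
have Xi := lt_le_trans k0 ki; have Xj := lt_le_trans k0 kj.
by rewrite ler_pM ?invr_ge0 ?lef_pV2 ?posrE ?(ltW Xi) ?(ltW Xj).
Qed.

End OneStep.
(** * Estimates on the clock *)

(** Discrete derivative of m^(-1/2): errors of order m^(-3/2) are paid for by its decrease. With x =
    sqrt m and y = sqrt (m + 1) <= 2 x, the gap is 1 / (x y (x + y)), at least 1 / (6 x^3). *)
Lemma inv_sqrt_gap (R : rcfType) (m : R) : 1 <= m ->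
  (m * Num.sqrt m)^-1 <= 8 * ((Num.sqrt m)^-1 - (Num.sqrt (m + 1))^-1).
Proof.
move=> m1; have m0 : 0 <= m by lra.
have m10 : 0 <= m + 1 by lra.
have ex := sqr_sqrtr m0; have ey := sqr_sqrtr m10.
have x1 : 1 <= Num.sqrt m by rewrite -[X in X <= _]sqrtr1 ler_wsqrtr.
have y0 := sqrtr_ge0 (m + 1).
move: (Num.sqrt m) (Num.sqrt (m + 1)) ex ey x1 y0 => x y ex ey x1 y0.
have xy : x <= y by rewrite -ler_sqr ?nnegrE; lra.
have y2 : y <= 2 * x by rewrite -ler_sqr ?nnegrE ?exprMn; [|lra|lra]; rewrite ex ey; lra.
have x0 : 0 < x by lra.
have yy : 0 < y by lra.
have -> : 8 * (x^-1 - y^-1) = 8 * (y ^+ 2 - x ^+ 2) / (x * y * (x + y)).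
  by field; rewrite !gt_eqF //; lra.
have -> : y ^+ 2 - x ^+ 2 = 1 by rewrite ey ex; ring.
rewrite mulr1 -ex.
rewrite ler_pdivlMr ?mulr_gt0 //; last by lra.
rewrite mulrC ler_pdivrMr ?mulr_gt0 ?exprn_gt0 //.
have -> : 8 * (x ^+ 2 * x) = x * (8 * x * x) by ring.
rewrite -mulrA ler_wpM2l ?(ltW x0) //.
apply: (@le_trans _ _ (2 * x * (3 * x))); last first.
  by have xx := mulr_ge0 (ltW x0) (ltW x0); lra.
by rewrite ler_pM //; lra.
Qed.

(** The predecessor shifts the blocks: for m > 1, level k means 16^k < m <= 16^(k + 1). The end of a
    block is thus still compared with its beginning, which lets consecutive blocks be chained. *)
Definition level (m : nat) : nat := trunc_log 16 m.-1.

Lemma level_le m : (1 < m)%N -> (16 ^ level m < m)%N.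
Proof.
by case: m => [|[|m]] // _; rewrite ltnS /level /=; apply: trunc_logP.
Qed.

(** When the level changes, the new reference clock is the present one, so that the comparison term
    restarts from 0. *)
Lemma level_step m : (1 < m)%N -> level m.+1 = level m \/ (16 ^ level m.+1)%N = m.
Proof.
move=> m1; have m0 : (0 < m)%N by exact: ltnW.
have [l1 l2] : (16 ^ level m.+1 <= m /\ m < 16 ^ (level m.+1).+1)%N.
  by rewrite /level /=; have := @trunc_log_bounds 16 m isT m0 => /andP[].
move: l1; rewrite leq_eqVlt => /orP[/eqP ->|l1]; [by right|left].
rewrite [in RHS]/level; apply/esym; apply: trunc_log_eq => //.
by case: m m1 m0 l1 l2 => [|m] //= _ _; rewrite ltnS => -> /ltnW.
Qed.

Lemma level_weight (R : rcfType) m : (0 < m)%N ->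
  ((4 ^ level m.+1)%N%:R : R) <= Num.sqrt m%:R.
Proof.
move=> m0; rewrite -[leLHS]ger0_norm ?ler0n // -sqrtr_sqr ler_wsqrtr //.
by rewrite -natrX ler_nat -expnM mulnC expnM /level /= trunc_logP.
Qed.

Lemma addr3_lt (R : numDomainType) (x y w t : R) : 0 <= x -> 0 <= y -> 0 <= w ->
  x + y + w < t -> [/\ x < t, y < t & w < t].
Proof.
move=> x0 y0 w0 lt; split; apply: le_lt_trans lt; rewrite ?lerDr ?addr_ge0 //.
  by rewrite -addrA lerDl addr_ge0.
by rewrite addrAC lerDr addr_ge0.
Qed.

(** Allots to each of x terms a share of the budget such that together they use less than one half;
    the other half is left for the [Kphi] term. *)
Lemma half_budget (R : realFieldType) (x : R) : 0 <= x ->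
  [/\ 0 < (2 * (x + 1))^-1, (2 * (x + 1))^-1 <= 1 & x * (2 * (x + 1))^-1 < 1 / 2].
Proof.
move=> x0; have x1 : 0 < 2 * (x + 1) by lra.
split; first by rewrite invr_gt0.
  by rewrite invf_le1 //; lra.
by rewrite ltr_pdivrMr //; lra.
Qed.
(** * Limits of sums and quotients *)

Lemma continuous_affine (R : realType) (p b s : R) :
  {for s, continuous (fun t : R => p + t * b)}.
Proof.
apply: (@cvgD _ _ _ _ _ (cst p) (fun t => t * b)); first exact: cvg_cst.
by apply: (@cvgM _ _ _ _ id (cst b)); [exact: cvg_id|exact: cvg_cst].
Qed.

Lemma cvg_finsum (R : realType) (T : Type) (F : set_system T) (FF : Filter F)
    (I : finType) (Q : pred I) (f : I -> T -> R) (l : I -> R) :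
  (forall i, Q i -> f i @ F --> l i) ->
  (fun t => \sum_(i | Q i) f i t) @ F --> \sum_(i | Q i) l i.
Proof.
move=> cf; rewrite (_ : (fun t => _) = \sum_(i | Q i) f i); last first.
  by apply/funext => t; rewrite fct_sumE.
apply: (big_ind2 (fun (g : T -> R) (y : R) => g @ F --> y)) => //; first exact: cvg_cst.
by move=> g1 y1 g2 y2 c1 c2; exact: cvgD.
Qed.

Lemma continuous_quot (R : realType) (f q : R -> R) (s : R) : q s != 0 ->
  {for s, continuous f} -> {for s, continuous q} -> {for s, continuous (fun t => f t / q t)}.
Proof. by move=> q0 cf cq; apply: (@cvgM _ _ _ _ f (fun t => (q t)^-1)) => //; exact: cvgV. Qed.

Lemma continuous_prod2 (R : realType) (f q : R -> R) (s : R) :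
  {for s, continuous f} -> {for s, continuous q} -> {for s, continuous (fun t => f t * q t)}.
Proof. by move=> cf cq; apply: (@cvgM _ _ _ _ f q). Qed.
(** * Steering *)

Lemma pos_lower_bound (R : realType) (I : finType) (Q : pred I) (f : I -> R) :
  (forall i, Q i -> 0 < f i) -> exists2 e, 0 < e & forall i, Q i -> e <= f i.
Proof.
move=> f0; exists (\big[Order.min/1]_(i | Q i) f i).
  by elim/big_ind: _ => // x y x0 y0; rewrite lt_min x0 y0.
by move=> i Qi; rewrite (bigD1 i) //= ge_min lexx.
Qed.

Section Network.
Variables (R : realType) (V : finType) (adj : rel V) (a : V -> V -> R) (pW : {set V} -> R).
Hypothesis adj_irr : irreflexive adj.
Hypothesis adj_sym : symmetric adj.
Hypothesis a_ge0 : forall i j, 0 <= a i j.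
Hypothesis a_sym : forall i j, a i j = a j i.
Hypothesis pW_ge0 : forall W, 0 <= pW W.
Hypothesis pW_sum : \sum_(W : {set V}) pW W = 1.
Variable v0 : V -> V -> R.
Hypothesis v0_sym : forall i j, v0 i j = v0 j i.
Hypothesis v0_ge0 : forall i j, 0 <= v0 i j.
Hypothesis v0_pos : forall i j, 0 < v0 i j <-> adj i j.
Variables (g : rel V) (N : {set V}) (A : V -> R).
Hypothesis g_sym : symmetric g.
Hypothesis g_sub : forall i j, g i j -> adj i j.
(** This and [g_leaf] express that [g] is a disjoint union of stars centred in [N], without
    mentioning components; [nuclei_star] derives both from the definition of nuclei. *)
Hypothesis g_bip : forall i j, g i j -> (i \in N) = (j \notin N).
Hypothesis g_leaf : forall l c c', l \notin N -> g l c -> g l c' -> c = c'.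

Notation pij := (pij adj pW).
Notation ap := (ap adj a pW).
Notation Vproc := (Vproc adj a v0).
Notation gain := (gain adj a).
Notation next := (next adj a).
Notation mean := (mean pW).

Hypothesis g_ap : forall c l, c \in N -> g c l -> ap c l = A c.
Hypothesis ap_pos_g : forall i j, g i j -> 0 < ap i j.
Hypothesis ap_cover : forall i j, 0 < ap i j -> exists k, g i k.

(** A mutual choice along an edge with [a i j] = 0 leaves all weights unchanged and is therefore
    permitted. *)
Definition admissible (s : step V) : Prop :=
  forall i j, rewarded adj s i j -> 0 < a i j -> g i j.

Lemma pij_ge0 i j : 0 <= pij i j.
Proof. by rewrite /Defs.pij; case: ifP => // _; apply: sumr_ge0. Qed.

Lemma pij_sym i j : pij i j = pij j i.
Proof.
by rewrite /Defs.pij adj_sym; case: ifP => // _; apply: eq_bigl => W; rewrite andbC.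
Qed.

Lemma ap_gt0 i j : (0 < ap i j) = (0 < a i j) && (0 < pij i j).
Proof.
rewrite /Defs.ap; have := a_ge0 i j; rewrite le_eqVlt => /orP[/eqP <-|a0].
  by rewrite mul0r ltxx.
by rewrite a0 pmulr_rgt0.
Qed.

Lemma g_a_gt0 i j : g i j -> 0 < a i j.
Proof. by move/ap_pos_g; rewrite ap_gt0 => /andP[]. Qed.

Lemma pij_gt0_ex i j : 0 < pij i j -> exists2 W, 0 < pW W & (i \in W) && (j \in W).
Proof.
rewrite /Defs.pij; case: ifP => _; last by rewrite ltxx.
move=> p0; apply: contrapT => nW.
have : \sum_(W : {set V} | (i \in W) && (j \in W)) pW W = 0.
  apply: big1 => W ijW; apply/eqP; rewrite eq_le pW_ge0 andbT leNgt.
  by apply/negP => W0; apply: nW; exists W.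
by move=> e; rewrite e ltxx in p0.
Qed.

Lemma pij_of_step (s : step V) i j : rewarded adj s i j -> 0 < pW s.2 -> 0 < pij i j.
Proof.
move=> /and5P[is2 js2 ij _ _] W0; rewrite /Defs.pij ij (bigD1 s.2) /=; last by rewrite is2.
by rewrite ltr_pwDl // sumr_ge0.
Qed.

Lemma gain_sym s i j : gain s i j = gain s j i.
Proof. by rewrite /gain (rewarded_sym adj_sym) a_sym. Qed.

Lemma gain_admissible s i j : admissible s -> ~~ g i j -> gain s i j = 0.
Proof.
move=> sok nij; rewrite /gain; case: ifP => // rij.
have := a_ge0 i j; rewrite le_eqVlt => /orP[/eqP <- //|a0].
by rewrite (sok _ _ rij a0) in nij.
Qed.

Lemma VprocS h n : Vproc h n.+1 = next (Vproc h n) (h n).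
Proof. by []. Qed.

Lemma Vproc_agree n h h' : agree n h h' -> Vproc h n = Vproc h' n.
Proof.
elim: n => // n IH hh; rewrite !VprocS IH ?hh // => k kn.
exact: hh (ltn_trans kn _).
Qed.

Lemma Vproc_sym h n i j : Vproc h n i j = Vproc h n j i.
Proof.
elim: n => [|n IH]; first exact: v0_sym.
by rewrite !VprocS /next IH gain_sym.
Qed.

Lemma Vproc_mono h n m i j : (n <= m)%N -> Vproc h n i j <= Vproc h m i j.
Proof.
move=> /subnK <-; elim: (m - n)%N => // k IH; rewrite addSn VprocS.
by rewrite (le_trans IH) // lerDl gain_ge0.
Qed.

Lemma Vproc_ge0 h n i j : 0 <= Vproc h n i j.
Proof. exact: le_trans (v0_ge0 i j) (Vproc_mono h _ _ (leq0n n)). Qed.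

Lemma Vproc_gt0 h n i j : adj i j -> 0 < Vproc h n i j.
Proof. move=> /v0_pos v; exact: lt_le_trans v (Vproc_mono h _ _ (leq0n n)). Qed.

Lemma Vproc_off h n i j : (forall k, (k < n)%N -> admissible (h k)) -> ~~ g i j ->
  Vproc h n i j = v0 i j.
Proof.
elim: n => // n IH hok nij; rewrite VprocS /next IH // ?(gain_admissible (hok n _)) ?addr0 //.
by move=> k kn; apply: hok; exact: ltn_trans kn _.
Qed.

(** One constant for two purposes: it bounds a single reinforcement, and it bounds the weight of a
    vertex outside its star. *)
Let K := \sum_i \sum_j (a i j + v0 i j).

Lemma av_le_K i j : a i j + v0 i j <= K.
Proof.
have av x y : 0 <= a x y + v0 x y by rewrite addr_ge0.
rewrite /K (bigD1 i) //= (bigD1 j) //= -addrA lerDl addr_ge0 //; apply: sumr_ge0 => // x _.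
exact: sumr_ge0.
Qed.

Lemma a_le_K i j : a i j <= K.
Proof. by apply: le_trans (av_le_K i j); rewrite lerDl. Qed.

Lemma v0_le_K i j : v0 i j <= K.
Proof. by apply: le_trans (av_le_K i j); rewrite lerDr. Qed.

Section Steering.
Variable z : V -> V -> R.
Hypothesis z_ge0 : forall c l, c \in N -> g c l -> 0 <= z c l.
Hypothesis z_sum : forall c l, c \in N -> g c l -> \sum_(k | g c k) z c k = 1.

Definition deficit (U : V -> V -> R) c l := z c l * hub g c U - U c l.

(* Greedy control keeps every deficit bounded below, hence, their sum being 0, bounded. *)
Definition balanced (U : V -> V -> R) :=
  forall c l, c \in N -> g c l -> - K <= deficit U c l.

Definition steered h n :=
  (forall k, (k < n)%N -> 0 < step_prob pW (Vproc h k) (h k) /\ admissible (h k)) /\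
  balanced (Vproc h n).

Lemma deficit_sum U c l : c \in N -> g c l -> \sum_(k | g c k) deficit U c k = 0.
Proof.
by move=> cN cl; rewrite /deficit sumrB -mulr_suml (z_sum cN cl) mul1r subrr.
Qed.

Lemma deficit_ge0_ex U c l : c \in N -> g c l -> exists2 k, g c k & 0 <= deficit U c k.
Proof.
move=> cN cl; apply: contrapT => nk.
have neg k : g c k -> deficit U c k < 0.
  by move=> ck; rewrite ltNge; apply/negP => dk; apply: nk; exists k.
have := deficit_sum U cN cl; rewrite (bigD1 l) //= => /eqP; apply/negP; rewrite lt_eqF //.
have S0 : \sum_(k | g c k && (k != l)) deficit U c k <= 0.
  by apply: sumr_le0 => k /andP[ck _]; rewrite ltW ?neg.
by have := neg l cl; lra.
Qed.

Lemma deficit_le U c l : balanced U -> c \in N -> g c l -> `|deficit U c l| <= #|V|%:R * K.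
Proof.
move=> bU cN cl; have K0 : 0 <= K by apply: le_trans (a_le_K c l).
rewrite ler_norml; apply/andP; split.
  apply: le_trans (bU _ _ cN cl); rewrite lerN2 ler_peMl // ler1n.
  by apply/card_gt0P; exists c.
have := deficit_sum U cN cl; rewrite (bigD1 l) //= => /eqP; rewrite addr_eq0 => /eqP ->.
rewrite -sumrN (@le_trans _ _ (\sum_(k | g c k && (k != l)) K)) //.
  by apply: ler_sum => k /andP[ck _]; rewrite lerNl bU.
rewrite big_mkcond (@le_trans _ _ (\sum_(k : V) K)) //.
  by apply: ler_sum => k _; case: ifP.
by rewrite sumr_const -[leLHS]mulr_natl.
Qed.

Lemma balanced0 : balanced v0.
Proof.
move=> c l cN cl; rewrite /deficit.
have : 0 <= z c l * hub g c v0 by rewrite mulr_ge0 ?z_ge0 // sumr_ge0.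
by have := v0_le_K c l; lra.
Qed.

Lemma steer_step h n c0 l0 : steered h n -> c0 \in N -> g c0 l0 -> exists2 h',
  steered h' n.+1 &
  agree n h h' /\ exists2 l, g c0 l & hub g c0 (Vproc h n) + a c0 l <= hub g c0 (Vproc h' n.+1).
Proof.
move=> [hn bn] cN0 cl0; set U := Vproc h n in bn *.
(* A vertex on no edge of [g] chooses any neighbour, or itself if it has none, which is the
   convention of [choice_prob]. *)
have fP i : exists j, [/\ (exists k, g i k) -> g i j /\ (i \in N -> 0 <= deficit U i j) &
   ~ (exists k, g i k) -> if [exists k, adj i k] then adj i j : Prop else j = i].
  have [[k ik]|nk] := pselect (exists k, g i k).
    have [iN|iN] := boolP (i \in N).
      by have [j ij dj] := deficit_ge0_ex U iN ik; exists j; split=> // -[]; exists k.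
    by exists k; split => // -[]; exists k.
  have [/existsP[j ij]|nj] := boolP [exists k, adj i k].
    by exists j; split.
  by exists i; split.
have [f Hf] := choice fP.
have f_g i k : g i k -> g i (f i) by move=> ik; case: (Hf i) => /(_ (ex_intro _ k ik)) [].
have f_d i k : g i k -> i \in N -> 0 <= deficit U i (f i).
  by move=> ik; case: (Hf i) => /(_ (ex_intro _ k ik)) [].
have f_l l c : l \notin N -> g l c -> f l = c.
  by move=> lN lc; apply: g_leaf (f_g _ _ lc) lc.
have := ap_pos_g (f_g _ _ cl0); rewrite ap_gt0 => /andP[_ /pij_gt0_ex[W W0 /andP[Wc Wf]]].
pose s : step V := ([ffun i => f i], W).
have rs : rewarded adj s c0 (f c0).
  have gf := f_g _ _ cl0.
  rewrite /rewarded /= Wc Wf g_sub // !ffunE eqxx /= (f_l (f c0) c0) //.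
    by rewrite -(g_bip gf).
  by rewrite g_sym.
(* A rewarded pair with [a i j] > 0 has [ap] > 0, because W has positive probability; by [ap_cover]
   the vertex i lies on an edge of [g], and so it chose along [g]. *)
have sok : admissible s.
  move=> i j rij a0; have p0 := pij_of_step rij W0.
  have [k ik] : exists k, g i k by apply: (ap_cover (j := j)); rewrite ap_gt0 a0.
  by move: rij => /and5P[_ _ _ /eqP + _]; rewrite ffunE => <-; exact: f_g ik.
have sp : 0 < step_prob pW U s.
  rewrite /step_prob mulr_gt0 // prodr_gt0 // => i _; rewrite ffunE.
  have Upos j : adj i j -> 0 < choice_prob U i j.
    move=> ij; have Uij : 0 < U i j by exact: Vproc_gt0.
    have xU : U i j <= xv U i.
      by rewrite /xv (bigD1 j) //= lerDl sumr_ge0 // => k _; exact: Vproc_ge0.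
    have x0 := lt_le_trans Uij xU.
    by rewrite /choice_prob gt_eqF // divr_gt0.
  have [[k ik]|nk] := pselect (exists k, g i k); first by apply: Upos; apply: g_sub; exact: f_g ik.
  have [_ /(_ nk)] := Hf i; case: ifP => [_|/existsP nj]; first exact: Upos.
  move=> ->; rewrite /choice_prob (_ : xv U i = 0) ?eqxx ?ltr01 //.
  apply: big1 => j _; rewrite /U Vproc_off //; last 2 first.
  - by move=> m mn; case: (hn m mn).
  - by apply/negP => ij; apply: nk; exists j.
  apply/eqP; rewrite eq_le v0_ge0 andbT leNgt; apply/negP => /v0_pos ij.
  by apply: nj; exists j.
have hU : Vproc (upd h n s) n = U by rewrite /U; apply/esym/Vproc_agree/upd_agree.
have hS : Vproc (upd h n s) n.+1 = next U s by rewrite VprocS hU /upd ltnn.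
exists (upd h n s); last first.
  split; first exact: upd_agree.
  exists (f c0); first exact: f_g cl0.
  rewrite hS hub_next lerD2l; apply: le_trans (gain_le_hub adj a_ge0 s (f_g _ _ cl0)).
  by rewrite /gain rs.
split.
  move=> k; rewrite ltnS leq_eqVlt => /orP[/eqP ->|kn].
    by rewrite hU /upd ltnn.
  rewrite (@Vproc_agree k (upd h n s) h); first by rewrite /upd kn; exact: hn.
  by move=> m mk; rewrite /upd (ltn_trans mk kn).
(* Growth of the star only raises the deficit. A reward of c l occurs only from a nonnegative
   deficit and lowers it by at most K. *)
rewrite hS => c l cN cl; rewrite /deficit hub_next mulrDr.
have zd : 0 <= z c l * hub_gain adj a g c s.
  by rewrite mulr_ge0 ?z_ge0 // hub_gain_ge0.
have := bn c l cN cl; rewrite /deficit /next /gain; case: ifP => [rcl|_]; last by lra.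
have := f_d c l cl cN; move: rcl => /and5P[_ _ _ /eqP + _]; rewrite ffunE => ->.
by have := a_le_K c l; rewrite /deficit; lra.
Qed.

Lemma steer_hub h n c0 l0 (M : R) : steered h n -> c0 \in N -> g c0 l0 ->
  exists h' n', [/\ (n <= n')%N, agree n h h', steered h' n' & M <= hub g c0 (Vproc h' n')].
Proof.
move=> sh cN cl0.
have [al al0 ale] : exists2 e, 0 < e & forall k, g c0 k -> e <= a c0 k.
  by apply: pos_lower_bound => k; exact: g_a_gt0.
suff H j : exists h' n', [/\ (n <= n')%N, agree n h h', steered h' n' &
     al *+ j <= hub g c0 (Vproc h' n')].
  have [j Mj] : exists j, M / al <= j%:R.
    exists (Num.bound `|M / al|); apply: le_trans (ler_norm _) _.
    by rewrite ltW // archi_boundP.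
  have [h' [n' [n1 n2 n3 n4]]] := H j; exists h', n'; split=> //; apply: le_trans n4.
  by rewrite -mulr_natl -ler_pdivrMr.
elim: j => [|j [h' [n' [n1 n2 n3 n4]]]].
  by exists h, n; split => //; rewrite mulr0n sumr_ge0 // => k _; exact: Vproc_ge0.
have [h'' s'' [ag [l cl le]]] := steer_step n3 cN cl0.
exists h'', n'.+1; split => //; first exact: leq_trans n1 _.
  by move=> k kn; rewrite n2 // ag // (leq_trans kn n1).
by apply: le_trans le; rewrite mulrSr lerD // ale.
Qed.

(** The nuclei are treated one after another; weights never decrease, so stars already large stay
    large. *)
Lemma steer_all (M : R) : exists h n, steered h n /\
  forall c l, c \in N -> g c l -> M <= hub g c (Vproc h n).
Proof.
suff [h [n [s H]]] : exists h n, steered h n /\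
  forall c l, c \in enum V -> c \in N -> g c l -> M <= hub g c (Vproc h n).
  by exists h, n; split=> // c l; apply: H; rewrite mem_enum.
elim: (enum V) => [|x r [h [n [sh H]]]].
  exists (fun=> ([ffun i => i], finset.set0)), 0%N; split => //; split => //; exact: balanced0.
have [[xN [l xl]]|nx] := pselect (x \in N /\ exists l, g x l); last first.
  exists h, n; split=> // c l; rewrite in_cons => /orP[/eqP ->|]; last exact: H.
  by move=> xN xl; case: nx; split => //; exists l.
have [h' [n' [n1 n2 n3 n4]]] := steer_hub M sh xN xl.
exists h', n'; split => // c k; rewrite in_cons => /orP[/eqP -> //|cr cN ck].
apply: le_trans (H _ _ cr cN ck) _; rewrite /hub; apply: ler_sum => j _.
by rewrite (Vproc_agree n2) Vproc_mono.
Qed.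

Theorem steering (M e : R) : 0 < e -> exists h n, [/\
  forall k, (k < n)%N -> 0 < step_prob pW (Vproc h k) (h k) /\ admissible (h k),
  forall c l, c \in N -> g c l -> M <= hub g c (Vproc h n) &
  forall c l, c \in N -> g c l -> `|ratio g c (Vproc h n) l - z c l| <= e].
Proof.
(* The error of a share is deficit / S, and the deficit is at most #|V| K at all times, so S >= #|V|
   K / e suffices; the 1 makes S positive. *)
move=> e0; have [h [n [[sh bh] H]]] := steer_all (`|M| + #|V|%:R * K / e + 1).
have K0 (c : V) : 0 <= #|V|%:R * K / e.
  by rewrite divr_ge0 ?mulr_ge0 ?ler0n ?(ltW e0) //; apply: le_trans (a_le_K c c).
have KM : 0 <= `|M| by [].
exists h, n; split => // c l cN cl; have := H c l cN cl; have k0 := K0 c => MS.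
  apply: le_trans MS; apply: (le_trans (ler_norm M)).
  by rewrite -addrA lerDl addr_ge0.
set S := hub _ _ _ in MS.
have S0 : 0 < S by apply: lt_le_trans MS; rewrite ltr_wpDl ?addr_ge0.
have -> : ratio g c (Vproc h n) l - z c l = - deficit (Vproc h n) c l / S.
  by rewrite /ratio /deficit -/S; field; rewrite gt_eqF.
rewrite normrM normrN normfV (gtr0_norm S0) ler_pdivrMr //.
apply: (le_trans (deficit_le bh cN cl)); rewrite [leRHS]mulrC -ler_pdivrMr //.
by apply: le_trans MS; rewrite addrAC lerDr addr_ge0.
Qed.

End Steering.
(** * Confinement *)

Lemma sum_v0_le_K i : \sum_j v0 i j <= K.
Proof.
apply: (@le_trans _ _ (\sum_j (a i j + v0 i j))).
  by apply: ler_sum => j _; rewrite lerDr.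
rewrite /K [leRHS](bigD1 i) //= lerDl sumr_ge0 // => x _.
by apply: sumr_ge0 => y _; rewrite addr_ge0.
Qed.

Lemma K_ge0 : 0 <= K.
Proof. by apply: sumr_ge0 => x _; apply: sumr_ge0 => y _; rewrite addr_ge0. Qed.

Lemma xv_hub_le h n c : (forall k, (k < n)%N -> admissible (h k)) ->
  xv (Vproc h n) c <= hub g c (Vproc h n) + K.
Proof.
move=> hok; rewrite /xv (bigID (g c)) /= lerD2l; apply: le_trans (sum_v0_le_K c).
rewrite [leRHS](bigID (g c)) /= -[leLHS]add0r lerD ?sumr_ge0 //.
by apply: ler_sum => j nj; rewrite Vproc_off.
Qed.

Lemma xv_leaf_le h n c l : (forall k, (k < n)%N -> admissible (h k)) ->
  c \in N -> g c l -> xv (Vproc h n) l <= Vproc h n c l + K.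
Proof.
move=> hok cN cl; rewrite /xv (bigD1 c) //= Vproc_sym lerD2l.
have lN : l \notin N by rewrite -(g_bip cl).
apply: le_trans (sum_v0_le_K l); rewrite [leRHS](bigD1 c) //= -[leLHS]add0r lerD //.
apply: ler_sum => j jc; rewrite Vproc_off //; apply: contra jc => lj.
by apply/eqP/(g_leaf lN) => //; rewrite g_sym.
Qed.

Lemma hub_gt0 h n c l : g c l -> 0 < hub g c (Vproc h n).
Proof.
move=> cl; rewrite /hub (bigD1 l) //= ltr_pwDl ?Vproc_gt0 ?g_sub // sumr_ge0 // => k _.
exact: Vproc_ge0.
Qed.

Lemma ratio_bounds h n c l : g c l -> 0 <= ratio g c (Vproc h n) l <= 1.
Proof.
move=> cl; have S0 := hub_gt0 h n cl; rewrite /ratio divr_ge0 ?Vproc_ge0 ?(ltW S0) //=.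
by rewrite ler_pdivrMr // mul1r edge_le_hub // => i j; exact: Vproc_ge0.
Qed.

Lemma A_gt0 c l : c \in N -> g c l -> 0 < A c.
Proof. by move=> cN cl; rewrite -(g_ap cN cl) ap_pos_g. Qed.

Section Confinement.
Variables (z : V -> V -> R) (ep ka : R) (n0 M0 : nat) (h0 : nat -> step V).
Hypothesis z_bnd : forall c l, c \in N -> g c l -> 0 <= z c l <= 1.
Hypothesis ep_gt0 : 0 < ep.
Hypothesis ka_gt0 : 0 < ka.
(** Below [Phi] < 1 a star has weight at least (A c / 2) clk and a share exceeds z - ep, so every
    edge of [g] has weight at least ka clk. *)
Hypothesis ka_le : forall c l, c \in N -> g c l -> ka <= A c / 2 * (z c l - ep).
Hypothesis M0_gt1 : (1 < M0)%N.
(** This turns drift^2 < clk^(3/2) into |drift| <= (A c / 2) clk. *)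
Hypothesis M0_large : forall c l, c \in N -> g c l -> 4 <= A c ^+ 2 * Num.sqrt M0%:R.
Hypothesis hub0 : forall c l, c \in N -> g c l -> A c * M0%:R <= hub g c (Vproc h0 n0).

Definition clk n := (n - n0 + M0)%N.
Definition drift h n c :=
  hub g c (Vproc h n) - hub g c (Vproc h n0) - A c * (n - n0)%:R.

(* The last time before n whose clock is a power of 16, or n0 (by truncation) if there is none:
   the ratios are compared to their value at that time, with a weight growing like the square
   root of the clock, so that the oscillations on successive blocks are summable. *)
Definition anchor n := (n0 + (16 ^ level (clk n) - M0))%N.

(* The denominator clk^(3/2) makes the conditional variance of the first term summable,
   and its boundedness still forces drift / clk to vanish. *)
Definition pot h n c l :=
  drift h n c ^+ 2 / ((clk n)%:R * Num.sqrt (clk n)%:R) +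
  (ratio g c (Vproc h n) l - z c l) ^+ 2 / ep ^+ 2 +
  (4 ^ level (clk n))%:R *
    (ratio g c (Vproc h n) l - ratio g c (Vproc h (anchor n)) l) ^+ 2.

Let Kg := \sum_i \sum_j a i j.
Let C1 c := #|V|%:R * (2 * A c * K).
Let C2 c := (2 * C1 c + 3 * Kg ^+ 2) / ka ^+ 2.

(** The summands, times clk^(-3/2), bound the mean increments of the three terms of [pot], in the
    same order. *)
Definition cost c := (2 * ka^-1 * C1 c + (A c + Kg) ^+ 2) + C2 c / ep ^+ 2 + C2 c.

Definition escape := \sum_i \sum_j pij i j * (v0 i j * v0 j i) / ka ^+ 2.

(* The factor 8 comes from inv_sqrt_gap: Kphi / sqrt clk pays for all later increases. *)
Definition Kphi :=
  8 * (\sum_(p : V * V | (p.1 \in N) && g p.1 p.2) cost p.1 + escape).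

Definition Phi n h :=
  \sum_(p : V * V | (p.1 \in N) && g p.1 p.2) pot h n p.1 p.2 +
  Kphi / Num.sqrt (clk n)%:R.

(** All earlier values of [Phi] are included, so that the condition is decreasing in n; the bounds k
    < n make it depend on the first n steps only, also for n < n0. *)
Definition confined n h :=
  [/\ forall k, (k < n)%N -> (k < n0)%N -> h k = h0 k,
      forall k, (k < n)%N -> admissible (h k) &
      forall k, (n0 <= k <= n)%N -> Phi k h < 1].

Lemma clk_gt1 n : (1 < clk n)%N.
Proof. exact: leq_trans M0_gt1 (leq_addl _ _). Qed.

Lemma clk_ge1 n : 1 <= ((clk n)%:R : R).
Proof. by rewrite ler1n ltnW ?clk_gt1. Qed.

Lemma clkS n : (n0 <= n)%N -> clk n.+1 = (clk n).+1.
Proof. by move=> nn; rewrite /clk subSn. Qed.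

Lemma clkRS n : (n0 <= n)%N -> ((clk n.+1)%:R : R) = (clk n)%:R + 1.
Proof. by move=> nn; rewrite clkS // -natr1. Qed.

Lemma sqrt_clk_ge1 n : 1 <= Num.sqrt ((clk n)%:R : R).
Proof. by rewrite -[leLHS]sqrtr1 ler_wsqrtr ?clk_ge1. Qed.

Lemma sqrt_clk_le n : Num.sqrt ((clk n)%:R : R) <= (clk n)%:R.
Proof.
have x1 := sqrt_clk_ge1 n; rewrite -[leRHS]sqr_sqrtr ?ler0n // expr2.
by rewrite ler_peMl // (le_trans _ x1).
Qed.

Lemma clk_weight_gt0 n : 0 < ((clk n)%:R * Num.sqrt (clk n)%:R : R).
Proof. by rewrite mulr_gt0 // (lt_le_trans ltr01) ?clk_ge1 ?sqrt_clk_ge1. Qed.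

Lemma anchor_le n : (n0 <= n)%N -> (anchor n <= n)%N.
Proof.
move=> nn; rewrite /anchor -leq_subRL // leq_subLR addnC.
exact: ltnW (level_le (clk_gt1 n)).
Qed.

Lemma drift_agree h h' n c : agree n h h' -> (n0 <= n)%N -> drift h n c = drift h' n c.
Proof.
move=> hh nn; rewrite /drift (Vproc_agree hh) (@Vproc_agree n0 h h') // => k kn.
exact: hh (leq_trans kn nn).
Qed.

Lemma anchor_agree h h' n : agree n h h' -> (n0 <= n)%N ->
  Vproc h (anchor n) = Vproc h' (anchor n).
Proof.
move=> hh nn; apply: Vproc_agree => k kn; apply: hh; exact: leq_trans kn (anchor_le nn).
Qed.

Lemma Phi_agree h h' n : agree n h h' -> (n0 <= n)%N -> Phi n h = Phi n h'.
Proof.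
move=> hh nn; rewrite /Phi /pot (Vproc_agree hh) (anchor_agree hh nn).
by under eq_bigr do rewrite (drift_agree _ hh nn).
Qed.

Lemma pot_ge0 h n c l : 0 <= pot h n c l.
Proof.
rewrite /pot; apply: addr_ge0; last by rewrite mulr_ge0 ?sqr_ge0 ?ler0n.
apply: addr_ge0; apply: divr_ge0; rewrite ?sqr_ge0 //; exact: ltW (clk_weight_gt0 n).
Qed.

Lemma C1_ge0 c l : c \in N -> g c l -> 0 <= C1 c.
Proof.
by move=> cN cl; rewrite /C1 !mulr_ge0 ?ler0n ?K_ge0 //; exact: ltW (A_gt0 cN cl).
Qed.

Lemma C2_ge0 c l : c \in N -> g c l -> 0 <= C2 c.
Proof.
move=> cN cl; have c1 := C1_ge0 cN cl; apply: divr_ge0; last exact: sqr_ge0.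
by apply: addr_ge0; apply: mulr_ge0; rewrite ?sqr_ge0.
Qed.

Lemma cost_ge0 c l : c \in N -> g c l -> 0 <= cost c.
Proof.
move=> cN cl; have c1 := C1_ge0 cN cl; have c2 := C2_ge0 cN cl.
apply: addr_ge0 => //; apply: addr_ge0; last by apply: divr_ge0; rewrite ?sqr_ge0.
apply: addr_ge0; last exact: sqr_ge0.
by apply: mulr_ge0 => //; apply: mulr_ge0; rewrite ?invr_ge0 // ltW.
Qed.

Lemma escape_ge0 : 0 <= escape.
Proof.
apply: sumr_ge0 => i _; apply: sumr_ge0 => j _.
by rewrite divr_ge0 ?sqr_ge0 // !mulr_ge0 ?pij_ge0.
Qed.

Lemma Kphi_ge0 : 0 <= Kphi.
Proof.
rewrite /Kphi mulr_ge0 // addr_ge0 ?escape_ge0 //; apply: sumr_ge0 => -[c l] /andP[] /=.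
exact: cost_ge0.
Qed.

Lemma Phi_ge0 h n : 0 <= Phi n h.
Proof.
rewrite /Phi addr_ge0 ?divr_ge0 ?Kphi_ge0 ?sqrtr_ge0 //; apply: sumr_ge0 => p _.
exact: pot_ge0.
Qed.

Lemma confined_local n h1 h2 : agree n h1 h2 -> confined n h1 -> confined n h2.
Proof.
move=> h12 [c1 c2 c3]; split.
- by move=> k kn kn0; rewrite -h12 // c1.
- by move=> k kn; rewrite -h12 //; exact: c2.
- move=> k /andP[k0 kn]; rewrite -(@Phi_agree h1) ?c3 ?k0 // => m mk.
  exact: h12 (leq_trans mk kn).
Qed.

Lemma confined_anti n h : confined n.+1 h -> confined n h.
Proof.
move=> [c1 c2 c3]; split.
- by move=> k kn; apply: c1; exact: leqW.
- by move=> k kn; apply: c2; exact: leqW.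
- by move=> k /andP[k0 kn]; apply: c3; rewrite k0 leqW.
Qed.

Lemma pot_lt1 h n c l : Phi n h < 1 -> c \in N -> g c l -> pot h n c l < 1.
Proof.
move=> P1 cN cl; apply: le_lt_trans P1.
rewrite /Phi (bigD1 (c, l)) /=; last by rewrite cN.
rewrite -addrA lerDl addr_ge0 ?divr_ge0 ?Kphi_ge0 ?sqrtr_ge0 //.
by apply: sumr_ge0 => p _; exact: pot_ge0.
Qed.

Lemma pot_terms_lt1 h n c l : Phi n h < 1 -> c \in N -> g c l ->
  [/\ drift h n c ^+ 2 / ((clk n)%:R * Num.sqrt (clk n)%:R) < 1,
      (ratio g c (Vproc h n) l - z c l) ^+ 2 / ep ^+ 2 < 1 &
      (4 ^ level (clk n))%:R *
        (ratio g c (Vproc h n) l - ratio g c (Vproc h (anchor n)) l) ^+ 2 < 1].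
Proof.
move=> P1 cN cl; apply: addr3_lt (pot_lt1 P1 cN cl).
- by apply: divr_ge0; rewrite ?sqr_ge0 // ltW // clk_weight_gt0.
- by apply: divr_ge0; rewrite ?sqr_ge0.
- by rewrite mulr_ge0 ?sqr_ge0 ?ler0n.
Qed.

Lemma drift_lt h n c l : Phi n h < 1 -> c \in N -> g c l ->
  drift h n c ^+ 2 < (clk n)%:R * Num.sqrt (clk n)%:R.
Proof.
move=> P1 cN cl; have [+ _ _] := pot_terms_lt1 P1 cN cl.
by rewrite ltr_pdivrMr ?clk_weight_gt0 // mul1r.
Qed.

Lemma ratio_lt h n c l : Phi n h < 1 -> c \in N -> g c l ->
  `|ratio g c (Vproc h n) l - z c l| < ep.
Proof.
move=> P1 cN cl; have [_ + _] := pot_terms_lt1 P1 cN cl.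
rewrite ltr_pdivrMr ?exprn_gt0 // mul1r => lt1.
by rewrite -ltr_sqr ?nnegrE ?(ltW ep_gt0) // real_normK ?num_real.
Qed.

Lemma ratio_anchor_lt h n c l : Phi n h < 1 -> c \in N -> g c l ->
  `|ratio g c (Vproc h n) l - ratio g c (Vproc h (anchor n)) l| < (2 ^ level (clk n))%:R^-1.
Proof.
move=> P1 cN cl; have [_ _ lt1] := pot_terms_lt1 P1 cN cl.
rewrite -ltr_sqr ?nnegrE ?invr_ge0 ?ler0n // real_normK ?num_real //.
rewrite exprVn -natrX -expnM mulnC expnM -[ltRHS]mul1r ltr_pdivlMr ?ltr0n ?expn_gt0 //.
by rewrite mulrC.
Qed.

Lemma drift_le h n c l : Phi n h < 1 -> c \in N -> g c l ->
  `|drift h n c| <= A c / 2 * (clk n)%:R.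
Proof.
move=> P1 cN cl; have A0 := A_gt0 cN cl; have dl := drift_lt P1 cN cl.
rewrite -ler_sqr ?nnegrE ?mulr_ge0 ?ler0n ?invr_ge0 ?(ltW A0) // real_normK ?num_real //.
apply: (le_trans (ltW dl)); set x := Num.sqrt _.
have xx : (clk n)%:R = x ^+ 2 by rewrite sqr_sqrtr ?ler0n.
have x0 : 0 <= x by exact: sqrtr_ge0.
have xM : 4 <= A c ^+ 2 * x.
  apply: le_trans (M0_large cN cl) _; rewrite ler_wpM2l ?sqr_ge0 //.
  by rewrite ler_wsqrtr // ler_nat leq_addl.
rewrite xx -subr_ge0 (_ : _ - _ = x ^+ 3 * (A c ^+ 2 * x - 4) / 4); last by field.
by rewrite divr_ge0 ?mulr_ge0 ?exprn_ge0 ?subr_ge0.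
Qed.

(** The star starts from at least A c M0, so it stays above A c clk - |drift|, and [drift_le] leaves
    half of this. *)
Lemma hub_ge h n c l : (n0 <= n)%N -> Phi n h < 1 -> agree n0 h0 h -> c \in N -> g c l ->
  A c / 2 * (clk n)%:R <= hub g c (Vproc h n).
Proof.
move=> nn P1 hh cN cl; have dl := drift_le P1 cN cl.
have hb := hub0 cN cl; rewrite (Vproc_agree hh) in hb.
have dl' : - (A c / 2 * (clk n)%:R) <= drift h n c by move: dl; rewrite ler_norml => /andP[].
move: hb dl'; rewrite /drift /clk natrD.
set Hn := hub _ _ (Vproc h n); set H0 := hub _ _ _; move: (M0%:R) ((n - n0)%:R) => x y.
have -> : A c / 2 * (y + x) = (A c * y + A c * x) / 2 by ring.
by lra.
Qed.

(** * The supermartingale property of the potential *)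

Section Step.
Variables (h : nat -> step V) (n : nat).
Hypothesis nn : (n0 <= n)%N.
Hypothesis cf : confined n h.

Let P1 : Phi n h < 1.
Proof. by case: cf => _ _; apply; rewrite nn leqnn. Qed.

Let hok : forall k, (k < n)%N -> admissible (h k).
Proof. by case: cf. Qed.

Let hh : agree n0 h0 h.
Proof. by case: cf => c1 _ _ k kn; rewrite c1 // (leq_trans kn nn). Qed.

Let U := Vproc h n.
Let m : R := (clk n)%:R.

Lemma edge_ge c l : c \in N -> g c l -> ka * m <= U c l.
Proof.
move=> cN cl; have S0 := hub_gt0 h n cl; have Sg := hub_ge nn P1 hh cN cl.
have -> : U c l = ratio g c U l * hub g c U by rewrite /ratio -mulrA mulVf ?mulr1 // gt_eqF.
have := ratio_lt P1 cN cl; rewrite ltr_norml => /andP[r1 _].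
have kz := ka_le cN cl; have A0 := A_gt0 cN cl.
have ze : 0 < z c l - ep.
  have : 0 < A c / 2 * (z c l - ep) by exact: lt_le_trans kz.
  by rewrite pmulr_rgt0 // divr_gt0.
apply: (@le_trans _ _ ((z c l - ep) * (A c / 2 * m))).
  by rewrite mulrCA mulrA ler_wpM2r ?ler0n.
by rewrite ler_pM ?(ltW ze) ?mulr_ge0 ?ler0n ?invr_ge0 ?(ltW A0) //; rewrite /U; lra.
Qed.

Lemma hub_ge_ka c l : c \in N -> g c l -> ka * m <= hub g c U.
Proof.
move=> cN cl; apply: le_trans (edge_ge cN cl) _; apply: edge_le_hub => // i j.
exact: Vproc_ge0.
Qed.

Lemma xv_ge i k : g i k -> ka * m <= xv U i.
Proof.
move=> ik; have : ka * m <= U i k.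
  have [iN|iN] := boolP (i \in N); first exact: edge_ge.
  have ki : g k i by rewrite g_sym.
  by rewrite /U Vproc_sym; apply: edge_ge => //; rewrite (g_bip ki).
move=> /le_trans -> //; rewrite /xv (bigD1 k) //= lerDl sumr_ge0 // => j _.
exact: Vproc_ge0.
Qed.

Lemma m_ge1 : 1 <= m. Proof. exact: clk_ge1. Qed.

(** Puts all errors on the common scale clk^(-3/2): w is 1 for the target term and for escapes, and
    4^level for the anchored term. *)
Lemma inv_sq_le (w x : R) : 0 <= w <= Num.sqrt m -> ka * m <= x ->
   w / x ^+ 2 <= (ka ^+ 2)^-1 / (m * Num.sqrt m).
Proof.
move=> /andP[w0 ws] kx; have m1 := m_ge1; have m0 : 0 < m by lra.
have km : 0 < ka * m by rewrite mulr_gt0.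
have s0 : 0 < Num.sqrt m by rewrite sqrtr_gt0.
apply: (@le_trans _ _ (Num.sqrt m / (ka * m) ^+ 2)).
  rewrite ler_pM ?invr_ge0 ?sqr_ge0 // lef_pV2 ?posrE ?exprn_gt0 ?(lt_le_trans km) //.
  by rewrite ler_sqr ?nnegrE ?(ltW km) // (le_trans (ltW km)).
rewrite le_eqVlt; apply/orP; left; apply/eqP.
have mm : m = Num.sqrt m ^+ 2 by rewrite sqr_sqrtr // ltW.
move: mm s0; move: (Num.sqrt m) => x' -> s0.
by field; rewrite !gt_eqF.
Qed.

Lemma Vproc_upd s : Vproc (upd h n s) n = U.
Proof. by apply/esym/Vproc_agree/upd_agree. Qed.

Lemma Vproc_updS s : Vproc (upd h n s) n.+1 = next U s.
Proof. by rewrite VprocS Vproc_upd /upd ltnn. Qed.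

Lemma Vproc_upd_le s k : (k <= n)%N -> Vproc (upd h n s) k = Vproc h k.
Proof.
by move=> kn; apply/esym/Vproc_agree => j jk; rewrite /upd (leq_trans jk kn).
Qed.

Lemma drift_upd s c : drift (upd h n s) n.+1 c = drift h n c + hub_gain adj a g c s - A c.
Proof.
rewrite /drift Vproc_updS hub_next Vproc_upd_le // subSn // -natr1 -/U; ring.
Qed.

Lemma pot_step c l : c \in N -> g c l ->
  mean U (fun s => pot (upd h n s) n.+1 c l) <= pot h n c l + cost c / (m * Num.sqrt m).
Proof.
move=> cN cl; have A0 := A_gt0 cN cl; have m1 := m_ge1.
have S0 := hub_gt0 h n cl; have Sk := hub_ge_ka cN cl; rewrite -/U in S0.
have U0 i j : 0 <= U i j by exact: Vproc_ge0.
have Us i j : U i j = U j i by exact: Vproc_sym.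
have gp k : g c k -> 0 < U c k by move=> ck; apply: Vproc_gt0; exact: g_sub.
have ga k : g c k -> ap c k = A c by exact: g_ap.
have gl k : g c k -> xv U k <= U c k + K by exact: xv_leaf_le.
have gh : xv U c <= hub g c U + K by exact: xv_hub_le.
have md : mean U (fun s => drift (upd h n s) n.+1 c ^+ 2) <=
    drift h n c ^+ 2 + (2 * ka^-1 * C1 c + (A c + Kg) ^+ 2).
  have dm : `|drift h n c| <= ka^-1 * hub g c U.
    rewrite mulrC ler_pdivlMr //; have dl := drift_lt P1 cN cl.
    have dm : `|drift h n c| <= m.
      rewrite -ler_sqr ?nnegrE ?ler0n // real_normK ?num_real //; apply: (le_trans (ltW dl)).
      by rewrite expr2 ler_wpM2l ?ler0n // sqrt_clk_le.
    by apply: le_trans Sk; rewrite mulrC ler_wpM2l // ltW.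
  have := hub_drift adj_irr a_ge0 pW_ge0 pW_sum U0 Us K_ge0 (ltW A0) gp ga gl gh S0 dm.
  rewrite invr_ge0 => /(_ (ltW ka_gt0)); apply: le_trans.
  by rewrite le_eqVlt; apply/orP; left; apply/eqP; apply: eq_bigr => s _; rewrite drift_upd.
have mr (y : R) : 0 <= y <= 1 ->
    mean U (fun s => (ratio g c (Vproc (upd h n s) n.+1) l - y) ^+ 2) <=
    (ratio g c U l - y) ^+ 2 + (2 * C1 c + 3 * Kg ^+ 2) / hub g c U ^+ 2.
  move=> y01.
  have := ratio_drift adj_irr a_ge0 pW_ge0 pW_sum U0 Us K_ge0 (ltW A0) gp ga gl gh S0 cl y01.
  apply: le_trans.
  by rewrite le_eqVlt; apply/orP; left; apply/eqP; apply: eq_bigr => s _; rewrite Vproc_updS.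
have c0 : 0 <= 2 * C1 c + 3 * Kg ^+ 2.
  have c1 := C1_ge0 cN cl.
  by apply: addr_ge0; apply: mulr_ge0; rewrite ?sqr_ge0.
have m0 : 0 < m by lra.
set q := (m * Num.sqrt m)^-1.
have q0 : 0 < q by rewrite invr_gt0 clk_weight_gt0.
have cS (w : R) : 0 <= w <= Num.sqrt m ->
    w * ((2 * C1 c + 3 * Kg ^+ 2) / hub g c U ^+ 2) <= C2 c * q.
  move=> w0; rewrite mulrCA /C2 -mulrA ler_wpM2l //.
  exact: inv_sq_le.
pose q1 : R := ((clk n.+1)%:R * Num.sqrt (clk n.+1)%:R)^-1.
have q10 : 0 <= q1 by rewrite invr_ge0 ltW // clk_weight_gt0.
have q1q : q1 <= q.
  rewrite /q1 /q lef_pV2 ?posrE ?clk_weight_gt0 // clkRS //.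
  by rewrite ler_pM ?sqrtr_ge0 ?(ltW m0) ?ler_wsqrtr // lerDl.
pose w1 : R := (4 ^ level (clk n.+1))%:R.
pose y1 := ratio g c (Vproc h (anchor n.+1)) l.
(* The next anchor is at most n, so the reference share is a constant for the conditional mean. *)
have an s : Vproc (upd h n s) (anchor n.+1) = Vproc h (anchor n.+1).
  apply: Vproc_upd_le; rewrite /anchor clkS // -leq_subRL // leq_subLR addnC -ltnS.
  by rewrite -/(clk n) level_le // ltnS ltnW ?clk_gt1.
have y01 : 0 <= y1 <= 1 by exact: ratio_bounds.
have w01 : 0 <= w1 <= Num.sqrt m.
  by rewrite ler0n /= /w1 clkS //; apply: level_weight; rewrite ltnW ?clk_gt1.
have -> : mean U (fun s => pot (upd h n s) n.+1 c l) =
    q1 * mean U (fun s => drift (upd h n s) n.+1 c ^+ 2) +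
    (ep ^+ 2)^-1 * mean U (fun s => (ratio g c (Vproc (upd h n s) n.+1) l - z c l) ^+ 2) +
    w1 * mean U (fun s => (ratio g c (Vproc (upd h n s) n.+1) l - y1) ^+ 2).
  rewrite -!meanZ -!meanD; apply: eq_bigr => s _; congr (_ * _).
  by rewrite /pot an [_ * q1]mulrC [_ / ep ^+ 2]mulrC.
have e2 : 0 <= (ep ^+ 2)^-1 by rewrite invr_ge0 sqr_ge0.
have t1 : q1 * mean U (fun s => drift (upd h n s) n.+1 c ^+ 2) <=
    drift h n c ^+ 2 * q + (2 * ka^-1 * C1 c + (A c + Kg) ^+ 2) * q.
  rewrite -mulrDl mulrC; apply: ler_pM => //.
  by apply: sumr_ge0 => s _; rewrite mulr_ge0 ?sqr_ge0 // step_prob_ge0.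
have t2 : (ep ^+ 2)^-1 * mean U (fun s => (ratio g c (Vproc (upd h n s) n.+1) l - z c l) ^+ 2)
    <= (ratio g c U l - z c l) ^+ 2 / ep ^+ 2 + C2 c / ep ^+ 2 * q.
  rewrite mulrC [_ / _ * q]mulrAC -mulrDl ler_wpM2r //.
  apply: le_trans (mr _ (z_bnd cN cl)) _; rewrite lerD2l -[leLHS]mul1r.
  by apply: cS; rewrite ler01 sqrt_clk_ge1.
have t3 : w1 * mean U (fun s => (ratio g c (Vproc (upd h n s) n.+1) l - y1) ^+ 2)
    <= (4 ^ level (clk n))%:R * (ratio g c U l - ratio g c (Vproc h (anchor n)) l) ^+ 2
       + C2 c * q.
  have w10 : 0 <= w1 by case/andP: w01.
  apply: (@le_trans _ _ (w1 * (ratio g c U l - y1) ^+ 2 + C2 c * q)).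
    apply: le_trans (ler_wpM2l w10 (mr _ y01)) _; rewrite mulrDr lerD2l; exact: cS.
  rewrite lerD2r /w1 /y1 /anchor clkS //.
  (* Either level and anchor are unchanged, or the new anchor is n itself and the left side is 0. *)
  have [->//|->] := level_step (clk_gt1 n).
  rewrite /clk addnK subnKC // subrr expr0n mulr0.
  by rewrite mulr_ge0 ?sqr_ge0.
apply: le_trans (lerD (lerD t1 t2) t3) _; rewrite /pot /cost -/U -/m -/q le_eqVlt.
by apply/orP; left; apply/eqP; ring.
Qed.

(** An edge off [g] that can be rewarded and has [a] > 0 satisfies [ap] > 0. Both of its ends then
    lie on edges of [g] and weigh at least ka clk, while the edge itself still has its initial
    weight. *)
Lemma mean_inadmissible_le :
  mean U (fun s => \sum_i \sum_(j | ~~ g i j && (0 < a i j)) (rewarded adj s i j)%:R)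
  <= escape / (m * Num.sqrt m).
Proof.
rewrite mean_sum /escape mulr_suml; apply: ler_sum => i _.
rewrite mean_sum mulr_suml big_mkcond; apply: ler_sum => j _.
have m1 := m_ge1.
have r0 : 0 <= pij i j * (v0 i j * v0 j i) / ka ^+ 2 / (m * Num.sqrt m).
  rewrite !divr_ge0 ?sqr_ge0 ?mulr_ge0 ?pij_ge0 ?sqrtr_ge0 //; lra.
case: ifP => // /andP[nij a0].
(* If [pij] vanishes, a reward requires a set of probability zero and contributes nothing. *)
have [p0|p0] := boolP (0 < pij i j); last first.
  apply: le_trans r0; rewrite /mean sumr_le0 // => s _.
  have [rij|nr] := boolP (rewarded adj s i j); last by rewrite mulr0.
  rewrite mulr1 /step_prob mulr_ge0_le0 //.
    by apply: prodr_ge0 => k _; apply: choice_prob_ge0 => x y; exact: Vproc_ge0.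
  by rewrite leNgt; apply: contra p0; exact: pij_of_step.
have ap0 : 0 < ap i j by rewrite ap_gt0 a0.
have [k ik] := ap_cover ap0.
have [k' jk] : exists k, g j k.
  by apply: (ap_cover (j := i)); rewrite ap_gt0 a_sym a0 (pij_sym j).
have km : 0 < ka * m by rewrite mulr_gt0 //; lra.
apply: le_trans (mean_escape adj_irr pW_ge0 _ km (xv_ge ik) (xv_ge jk)) _.
  by move=> x y; exact: Vproc_ge0.
have nji : ~~ g j i by rewrite g_sym.
rewrite /U !(Vproc_off hok) //.
rewrite -[leRHS]mulrA ler_wpM2l ?mulr_ge0 ?pij_ge0 //.
rewrite -[leLHS]mul1r; apply: inv_sq_le => //.
by rewrite ler01 sqrt_clk_ge1.
Qed.

Lemma Phi_step : \sum_s step_prob pW U s *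
    (if `[< confined n.+1 (upd h n s) >] then Phi n.+1 (upd h n s) else 1) <= Phi n h.
Proof.
have m1 := m_ge1.
have U0 i j : 0 <= U i j by exact: Vproc_ge0.
(* The value 1 taken on leaving is dominated in both cases: either the next [Phi] is at least 1, or
   the step is inadmissible and the number of forbidden rewards is at least 1. *)
apply: (@le_trans _ _ (mean U (fun s => Phi n.+1 (upd h n s) +
   \sum_i \sum_(j | ~~ g i j && (0 < a i j)) (rewarded adj s i j)%:R))).
  apply: mean_le => // s.
  have r0 : 0 <= \sum_i \sum_(j | ~~ g i j && (0 < a i j)) ((rewarded adj s i j)%:R : R).
    by apply: sumr_ge0 => i _; apply: sumr_ge0 => j _.
  case: asboolP => [_|ncf]; first by rewrite lerDl.
  have [sok|nok] := pselect (admissible s).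
    have [lt1|ge1] := ltP (Phi n.+1 (upd h n s)) 1; last by rewrite -[leLHS]addr0 lerD.
    case: ncf; case: cf => c1 c2 c3; split.
    - move=> k; rewrite ltnS leq_eqVlt => /orP[/eqP ->|kn]; first by rewrite ltnNge nn.
      by rewrite /upd kn; exact: c1.
    - move=> k; rewrite ltnS leq_eqVlt /upd => /orP[/eqP ->|kn]; first by rewrite ltnn.
      by rewrite kn; exact: c2.
    - move=> k /andP[k0]; rewrite leq_eqVlt => /orP[/eqP -> //|kn].
      rewrite -(@Phi_agree h) // ?c3 ?k0 // => j jk.
      by rewrite /upd (leq_trans jk).
  have [i [j [rij nij a0]]] : exists i j, [/\ rewarded adj s i j, ~~ g i j & 0 < a i j].
    apply: contrapT => nex; apply: nok => i j rij a0; apply: contrapT => /negP nij.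
    by apply: nex; exists i, j.
  rewrite -[leLHS]add0r lerD ?Phi_ge0 // (bigD1 i) //= (bigD1 j) /=; last by rewrite nij.
  rewrite rij -addrA lerDl addr_ge0 //; first by apply: sumr_ge0.
  by apply: sumr_ge0 => x _; apply: sumr_ge0.
rewrite meanD {1}/Phi meanD mean_sum (mean_cst pW_sum).
have ps : \sum_(p : V * V | (p.1 \in N) && g p.1 p.2)
      mean U (fun s => pot (upd h n s) n.+1 p.1 p.2) <=
    \sum_(p : V * V | (p.1 \in N) && g p.1 p.2)
      (pot h n p.1 p.2 + cost p.1 / (m * Num.sqrt m)).
  by apply: ler_sum => p /andP[pN pg]; exact: pot_step.
apply: (le_trans (lerD (lerD ps (lexx _)) mean_inadmissible_le)).
rewrite big_split /= -mulr_suml /Phi.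
(* The decrease of [Kphi] / sqrt clk compensates for the sum of all costs. *)
have gap := inv_sqrt_gap m1; rewrite -clkRS // in gap.
have kk : 0 <= Kphi / 8 by rewrite divr_ge0 ?Kphi_ge0.
have := ler_wpM2l kk gap.
rewrite /Kphi; set s1 := \sum_(_ | _) pot _ _ _ _; set s2 := \sum_(_ | _) cost _.
rewrite -/m; set q := (m * Num.sqrt m)^-1; set x := (Num.sqrt m)^-1; set y := (Num.sqrt _)^-1.
set t := s2 + escape.
have -> : 8 * t / 8 * q = s2 * q + escape * q by rewrite /t; field.
have -> : 8 * t / 8 * (8 * (x - y)) = 8 * t * x - 8 * t * y by field.
by lra.
Qed.

End Step.
End Confinement.
(** * Convergence of the confined process *)

Section Limits.
Variables (z : V -> V -> R) (ep ka : R) (n0 k0 : nat) (h : nat -> step V).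
Hypothesis ep_gt0 : 0 < ep.
Hypothesis ka_gt0 : 0 < ka.
Hypothesis k0_gt0 : (0 < k0)%N.
Hypothesis Phi_lt1 : forall n, (n0 <= n)%N -> Phi z ep ka n0 (16 ^ k0) n h < 1.
Variables (c l : V).
Hypothesis cN : c \in N.
Hypothesis cl : g c l.

Let m n : R := (clk n0 (16 ^ k0) n)%:R.
Let r n := ratio g c (Vproc h n) l.
(** The scale is 16 despite the name: for k >= k0 this is the time at which the clock equals
    16^k. *)
Let dyadic k := (n0 + (16 ^ k - 16 ^ k0))%N.

Let M0_gt1 : (1 < 16 ^ k0)%N.
Proof. by rewrite -(exp1n k0) ltn_exp2r. Qed.

Lemma clk_large (x : R) : \forall n \near \oo, (n0 <= n)%N /\ x <= m n.
Proof.
near=> n.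
have nn : (n0 <= n)%N by near: n; exact: nbhs_infty_ge.
split=> //; apply: (@le_trans _ _ (n%:R - n0%:R)); last first.
  by rewrite /m /clk -natrB // ler_nat leq_addr.
rewrite lerBrDr; near: n; exact: nbhs_infty_ger.
Unshelve. all: by end_near. Qed.

(** From drift^2 < clk^(3/2) follows |drift| / clk < clk^(-1/4), which is at most e / 2 once clk >=
    (e / 2)^(-4); the remaining difference is a constant divided by clk. *)
Lemma hub_rate : (fun n => hub g c (Vproc h n) / m n) @ \oo --> A c.
Proof.
apply/cvgrPdist_le => e e0.
pose k := `|hub g c (Vproc h n0) - A c * (16 ^ k0)%N%:R|.
have e2 : 0 < e / 2 by rewrite divr_gt0.
near=> n.
have [[nn mk] [_ ms]] : ((n0 <= n)%N /\ k / (e / 2) <= m n) /\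
    ((n0 <= n)%N /\ ((e / 2) ^- 2) ^+ 2 <= m n).
  by split; near: n; exact: clk_large.
have m1 : 1 <= m n by exact: clk_ge1.
have m0 : 0 < m n by lra.
have -> : A c - hub g c (Vproc h n) / m n =
   - ((hub g c (Vproc h n0) - A c * (16 ^ k0)%N%:R) / m n + drift n0 h n c / m n).
  rewrite /drift {1}(_ : A c = A c * ((n - n0)%:R + (16 ^ k0)%N%:R) / m n).
    by field; rewrite gt_eqF.
  by rewrite -natrD mulfK // gt_eqF.
rewrite normrN; apply: (le_trans (ler_normD _ _)); rewrite (splitr e) lerD //.
  by rewrite normrM normfV (gtr0_norm m0) ler_pdivrMr // [leRHS]mulrC -ler_pdivrMr.
rewrite normrM normfV (gtr0_norm m0) ler_pdivrMr //.
have em : 0 <= e / 2 * m n by exact: mulr_ge0 (ltW e2) (ltW m0).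
rewrite -ler_sqr ?nnegrE ?em // real_normK ?num_real //.
have /ltW dl := drift_lt ka_gt0 M0_gt1 (Phi_lt1 nn) cN cl.
apply: (le_trans dl); rewrite exprMn -/(m n).
have sm : (e / 2) ^- 2 <= Num.sqrt (m n).
  by rewrite -[leLHS]ger0_norm ?invr_ge0 ?sqr_ge0 // -sqrtr_sqr ler_wsqrtr.
have mm : m n = Num.sqrt (m n) ^+ 2 by rewrite sqr_sqrtr // ltW.
have s0 := sqrtr_ge0 (m n).
move: (Num.sqrt (m n)) sm mm s0 => s sm -> s0; move: sm.
rewrite -[(e / 2) ^- 2]mulr1 ler_pdivrMl ?exprn_gt0 // => sm.
rewrite (_ : _ * (s ^+ 2) ^+ 2 = s ^+ 2 * s * ((e / 2) ^+ 2 * s)); last by ring.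
by rewrite ler_peMr // mulr_ge0 ?sqr_ge0.
Unshelve. all: by end_near. Qed.

Lemma clk_dyadic k : (k0 <= k)%N -> clk n0 (16 ^ k0) (dyadic k) = (16 ^ k)%N.
Proof. by move=> kk; rewrite /clk /dyadic addKn subnK // leq_exp2l. Qed.

Lemma dyadic_clk k n : (n0 <= n)%N -> clk n0 (16 ^ k0) n = (16 ^ k)%N -> n = dyadic k.
Proof. by move=> nn; rewrite /clk /dyadic => <-; rewrite addnK subnKC. Qed.

Lemma dyadic_ge k : (n0 <= dyadic k)%N. Proof. exact: leq_addr. Qed.

(** Chaining over blocks: up to clock 16^(i + 1) the share stays within 2^-i of its value at clock
    16^i, and the bound is the sum of 2^-i over k <= i < k + j. *)
Lemma ratio_dyadic_close k j n : (k0 <= k)%N -> (n0 <= n)%N ->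
  (16 ^ k <= clk n0 (16 ^ k0) n <= 16 ^ (k + j))%N ->
  `|r n - r (dyadic k)| <= 2 * (2 ^+ k)^-1 - 2 * (2 ^+ (k + j))^-1.
Proof.
move=> kk; elim: j n => [|j IH] n nn /andP[ge le].
  rewrite addn0 in le *; rewrite [n in r n](@dyadic_clk k n) ?subrr ?normr0 //.
  by apply/eqP; rewrite eqn_leq le.
have [le'|gt] := leqP (clk n0 (16 ^ k0) n) (16 ^ (k + j)).
  apply: le_trans (IH n nn _) _; first by rewrite ge.
  rewrite lerD2l lerN2 ler_wpM2l // lef_pV2 ?posrE ?exprn_gt0 // addnS.
  by rewrite exprS ler_peMl ?exprn_ge0 //; lra.
have lev : level (clk n0 (16 ^ k0) n) = (k + j)%N.
  apply: trunc_log_eq => //; move: gt le; rewrite addnS.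
  by case: (clk _ _ _) => //= x; rewrite ltnS => ->.
have := ratio_anchor_lt ka_gt0 (Phi_lt1 nn) cN cl.
rewrite lev /anchor lev -/(dyadic (k + j)) -/(r n) -/(r (dyadic _)) natrX => /ltW h1.
have kj : (k0 <= k + j)%N by rewrite (leq_trans kk) ?leq_addr.
have h2 := IH (dyadic (k + j)) (dyadic_ge _).
have {}h2 : `|r (dyadic (k + j)) - r (dyadic k)| <= 2 * (2 ^+ k)^-1 - 2 * (2 ^+ (k + j))^-1.
  by apply: h2; rewrite clk_dyadic // leqnn andbT leq_exp2l ?leq_addr.
rewrite (_ : r n - _ = (r n - r (dyadic (k + j))) + (r (dyadic (k + j)) - r (dyadic k))); last by ring.
apply: (le_trans (ler_normD _ _)); apply: (le_trans (lerD h1 h2)).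
rewrite addnS exprS invfM.
by rewrite le_eqVlt; apply/orP; left; apply/eqP; field; rewrite !expf_neq0 // pnatr_eq0.
Qed.

Lemma ratio_cvg : exists2 y, (fun n => r n) @ \oo --> y & `|y - z c l| <= ep.
Proof.
have cr : cvg (r @ \oo).
  apply/cauchy_cvgP; apply: cauchy_exP => e e0.
  have [k kk ke] : exists2 k, (k0 <= k)%N & 2 * (2 ^+ k)^-1 < e.
    exists (k0 + Num.bound (2 / e))%N; first exact: leq_addr.
    rewrite ltr_pdivrMr ?exprn_gt0 // mulrC -ltr_pdivrMr //.
    apply: (@lt_trans _ _ (Num.bound (2 / e))%:R).
      by rewrite archi_boundP // divr_ge0 // ltW.
    rewrite -natrX ltr_nat; apply: leq_ltn_trans (leq_addl k0 _) _; exact: ltn_expl.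
  exists (r (dyadic k)).
  suff : \forall n \near \oo, `|r (dyadic k) - r n| < e by [].
  near=> n.
  have [nn mk] : (n0 <= n)%N /\ (16 ^ k)%N%:R <= m n by near: n; exact: clk_large.
  apply: le_lt_trans ke; rewrite distrC.
  (* The bound is below 2 / 2^k whatever the number of blocks; the clock m itself is a sufficient
     number, as m < 16^m. *)
  have := @ratio_dyadic_close k (clk n0 (16 ^ k0) n) n kk nn.
  rewrite ler_nat in mk; rewrite mk /=.
  have le : (clk n0 (16 ^ k0) n <= 16 ^ (k + clk n0 (16 ^ k0) n))%N.
    by apply: ltnW; apply: leq_trans (ltn_expl _ (isT : 1 < 16)%N) _; rewrite leq_exp2l ?leq_addl.
  move=> /(_ le); move=> /le_trans; apply.
  by rewrite gerBl mulr_ge0 // invr_ge0 exprn_ge0.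
exists (lim (r @ \oo)) => //.
have close : \forall n \near \oo, `|r n - z c l| <= ep.
  near=> n; apply/ltW/(ratio_lt ep_gt0 ka_gt0) => //; apply: Phi_lt1.
  by near: n; exact: nbhs_infty_ge.
have b1 : lim (r @ \oo) <= z c l + ep.
  apply: limr_le => //; near=> n.
  have : `|r n - z c l| <= ep by near: n.
  by rewrite ler_norml => /andP[_]; rewrite lerBlDl.
have b2 : z c l - ep <= lim (r @ \oo).
  apply: limr_ge => //; near=> n.
  have : `|r n - z c l| <= ep by near: n.
  by rewrite ler_norml => /andP[+ _]; rewrite lerBrDl.
by rewrite ler_norml; apply/andP; split; lra.
Unshelve. all: by end_near. Qed.

End Limits.

(** The order of the choices avoids circularity: [ep] comes from e and the targets, [ka] from [ep],
    and [Kphi] depends on these two but not on the starting time or clock. The clock 16^k0 is then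
    taken large, and last comes the path steering to stars of that size. *)
Theorem confinement (z : V -> V -> R) (e : R) (d : measure_display)
    (T : measurableType d) (P : probability T R) (X : nat -> T -> step V)
    (X_meas : forall n h, measurable (cyl X n h))
    (X_law : forall n h, P (cyl X n h) =
      (\prod_(k < n) step_prob pW (Vproc h k) (h k))%:E) :
  (forall c l, c \in N -> g c l -> 0 < z c l) ->
  (forall c l, c \in N -> g c l -> \sum_(k | g c k) z c k = 1) ->
  0 < e ->
  exists ep ka n0 k0 (B : set T), [/\ [/\ 0 < ep, ep <= e, 0 < ka & (0 < k0)%N],
    forall c l, c \in N -> g c l -> ep < z c l,
    measurable B, (0 < P B)%E &
    forall t, B t -> (forall k, admissible (X k t)) /\
      forall n, (n0 <= n)%N -> Phi z ep ka n0 (16 ^ k0) n (fun k => X k t) < 1].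
Proof.
move=> z0 zs e0.
pose pr (p : V * V) := (p.1 \in N) && g p.1 p.2.
have z_bnd c l : c \in N -> g c l -> 0 <= z c l <= 1.
  move=> cN cl; rewrite ltW ?z0 //= -(zs c l cN cl) (bigD1 l) //= lerDl sumr_ge0 //.
  by move=> k /andP[ck _]; rewrite ltW ?z0.
have [ez ez0 ezle] : exists2 ez, 0 < ez & forall p, pr p -> ez <= z p.1 p.2 / 2.
  by apply: pos_lower_bound => p /andP[pN pg]; rewrite divr_gt0 ?z0.
pose ep := Num.min e ez.
have ep0 : 0 < ep by rewrite lt_min e0.
have epz c l : c \in N -> g c l -> ep < z c l.
  move=> cN cl; have zz := z0 c l cN cl.
  have : ep <= z c l / 2 by rewrite ge_min (ezle (c, l)) ?orbT //; rewrite /pr cN.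
  by move=> h1; apply: le_lt_trans h1 _; lra.
have [ka ka0 kale] : exists2 ka, 0 < ka &
    forall p, pr p -> ka <= A p.1 / 2 * (z p.1 p.2 - ep).
  apply: pos_lower_bound => p /andP[pN pg].
  by rewrite mulr_gt0 ?divr_gt0 ?(A_gt0 pN pg) // subr_gt0 epz.
have [al al0 alle] : exists2 al, 0 < al & forall p, pr p -> al <= A p.1 ^+ 2.
  by apply: pos_lower_bound => p /andP[pN pg]; rewrite exprn_gt0 ?(A_gt0 pN pg).
have K10 : 0 <= Kphi ep ka by exact: Kphi_ge0.
(* The square root of the initial clock, 4^k0, will exceed x: the first term gives [M0_large], the
   second makes the [Kphi] term at most 1/2. *)
pose x := 4 / al + 2 * Kphi ep ka.
have fa : 0 <= 4 / al by rewrite divr_ge0 // ltW.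
have x0 : 0 <= x by rewrite addr_ge0 // mulr_ge0.
pose k0 := (Num.bound x).+1.
have M0E : Num.sqrt ((16 ^ k0)%N%:R : R) = (4 ^ k0)%N%:R.
  rewrite (_ : 16 = 4 ^ 2)%N // -expnM mulnC expnM natrX sqrtr_sqr ger0_norm //.
have xk : x <= (4 ^ k0)%N%:R.
  apply: (@le_trans _ _ (Num.bound x)%:R); first by rewrite ltW // archi_boundP.
  by rewrite ler_nat /k0; apply: leq_trans (leqnSn _) _; apply/ltnW/ltn_expl.
have M0_large c l : c \in N -> g c l -> 4 <= A c ^+ 2 * Num.sqrt (16 ^ k0)%N%:R.
  move=> cN cl; rewrite M0E.
  have aA : al <= A c ^+ 2 by apply: (alle (c, l)); rewrite /pr cN.
  apply: (@le_trans _ _ (al * (4 / al))); first by rewrite mulrC divfK // gt_eqF.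
  apply: ler_pM => //; first exact: ltW.
  by apply: le_trans xk; rewrite lerDl mulr_ge0.
have M0_gt1 : (1 < 16 ^ k0)%N by rewrite -(exp1n k0) ltn_exp2r.
pose np : R := #|{: V * V}|%:R.
(* Steering to within ep tt makes the initial potential of each pair at most tt^2 <= tt, and all
   pairs together stay below 1/2. *)
pose tt := (2 * (np + 1))^-1.
have np0 : 0 <= np by rewrite ler0n.
have [tt0 tt1 s2] := half_budget np0.
have [h0 [n0 [hp hM hz]]] := @steering z (fun c l cN cl => ltW (z0 c l cN cl)) zs
   (\sum_c `|A c| * (16 ^ k0)%N%:R) (ep * tt) (mulr_gt0 ep0 tt0).
have hub0 c l : c \in N -> g c l -> A c * (16 ^ k0)%N%:R <= hub g c (Vproc h0 n0).
  move=> cN cl; apply: le_trans (hM c l cN cl); rewrite (bigD1 c) //=.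
  rewrite -[leLHS]addr0 lerD //; first by rewrite ler_wpM2r ?ler0n ?ler_norm.
  by apply: sumr_ge0 => k _; rewrite mulr_ge0 ?ler0n.
have Phi0 : Phi z ep ka n0 (16 ^ k0) n0 h0 < 1.
  (* At time n0 the drift is 0 and the anchor is n0 itself, so only the distance to the target
     remains. *)
  have ck : clk n0 (16 ^ k0) n0 = (16 ^ k0)%N by rewrite /clk subnn.
  have an : anchor n0 (16 ^ k0) n0 = n0.
    rewrite /anchor ck (_ : (_ - _)%N = 0%N) ?addn0 //.
    by apply/eqP; rewrite subn_eq0; apply/ltnW/level_le.
  rewrite /Phi.
  have s1 : \sum_(p : V * V | pr p) pot z ep n0 (16 ^ k0) h0 n0 p.1 p.2 <= np * tt.
    apply: (@le_trans _ _ (\sum_(p : V * V | pr p) tt)).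
      apply: ler_sum => -[c l] /andP[/= cN cl].
      rewrite /pot an /drift subrr subnn mulr0 subrr !expr0n /= mul0r subrr expr0n mulr0 add0r addr0.
      rewrite -expr_div_n -[leLHS]ger0_norm ?sqr_ge0 // normrX.
      have q1 : `|(ratio g c (Vproc h0 n0) l - z c l) / ep| <= tt.
        by rewrite normrM normfV (gtr0_norm ep0) ler_pdivrMr // mulrC hz.
      apply: (@le_trans _ _ (tt ^+ 2)); first by rewrite ler_sqr ?nnegrE ?(ltW tt0).
      by rewrite expr2 ler_piMl // ltW.
    rewrite big_mkcond (@le_trans _ _ (\sum_(p : V * V) tt)) //.
      by apply: ler_sum => p _; case: ifP => // _; exact: ltW.
    by rewrite sumr_const -[leLHS]mulr_natl.
  have s3 : Kphi ep ka / Num.sqrt (clk n0 (16 ^ k0) n0)%:R <= 1 / 2.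
    rewrite ck M0E ler_pdivrMr ?ltr0n ?expn_gt0 // mul1r ler_pdivlMl //.
    by apply: le_trans xk; rewrite lerDr.
  by apply: (le_lt_trans (lerD s1 s3)); rewrite [ltRHS](splitr 1) ltrD2r.
have zep c l : c \in N -> g c l -> ka <= A c / 2 * (z c l - ep).
  by move=> cN cl; apply: (kale (c, l)); rewrite /pr cN.
have cf0 : confined z ep ka n0 (16 ^ k0) h0 n0 h0.
  split=> //; first by move=> k kn; case: (hp k kn).
  by move=> k /andP[k1 k2]; rewrite (_ : k = n0) //; apply/eqP; rewrite eqn_leq k2.
have pp : 0 < path_prob (fun n h s => step_prob pW (Vproc h n) s) n0 h0.
  by apply: prodr_gt0 => k _; case: (hp k (ltn_ord k)).
have [] := @survival R (step V) d T P X (fun n h s => step_prob pW (Vproc h n) s)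
  _ X_meas X_law n0 (confined z ep ka n0 (16 ^ k0) h0) (Phi z ep ka n0 (16 ^ k0))
  _ _ _ _ _ h0 cf0 pp Phi0.
- by move=> n h h' hh s; rewrite (Vproc_agree hh).
- by move=> n h _ s; apply: step_prob_ge0 => // i j; exact: Vproc_ge0.
- move=> n h1 h2; exact: confined_local.
- move=> n h; exact: confined_anti.
- move=> n h _; exact: Phi_ge0.
- move=> n h nn cf; exact: (Phi_step z_bnd ep0 ka0 zep M0_gt1 M0_large hub0 nn cf).
move=> mB PB.
exists ep, ka, n0, k0, (cyl X n0 h0 `&`
  [set t | forall n, confined z ep ka n0 (16 ^ k0) h0 n (fun k => X k t)]).
split => //; first by split => //; rewrite ge_min lexx.
move=> t [_ Bt]; split.
  by move=> k; case: (Bt k.+1) => _ c2 _; exact: c2.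
by move=> n nn; case: (Bt n) => _ _; apply; rewrite nn leqnn.
Qed.
(** * The Jacobian *)

Lemma ap_sym i j : ap i j = ap j i.
Proof. by rewrite /Defs.ap a_sym pij_sym. Qed.

(** * Arrays supported on a union of stars *)

Section Arrays.
Variable u : V -> V -> R.
Hypothesis u_sym : forall i j, u i j = u j i.
Hypothesis u_off : forall i j, ~~ g i j -> u i j = 0.
Hypothesis u_gt0 : forall i j, g i j -> 0 < u i j.
Hypothesis A_isolated : forall c, (forall l, ~~ g c l) -> A c = 0.

Lemma array_ge0 i j : 0 <= u i j.
Proof. by have [/u_gt0/ltW//|/u_off ->] := boolP (g i j). Qed.

Lemma xv_gt0 i j : g i j -> 0 < xv u i.
Proof.
move=> ij; rewrite /xv (bigD1 j) //= ltr_pwDl ?u_gt0 // sumr_ge0 // => k _.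
exact: array_ge0.
Qed.

Lemma xv_g i : xv u i = \sum_(j | g i j) u i j.
Proof.
by rewrite /xv (bigID (g i)) /= [X in _ + X]big1 ?addr0 // => j; exact: u_off.
Qed.

Lemma xv_leaf c l : c \in N -> g c l -> xv u l = u c l.
Proof.
move=> cN cl; have lN : l \notin N by rewrite -(g_bip cl).
rewrite xv_g (bigD1 c) /=; last by rewrite g_sym.
rewrite big1 ?addr0 // => j /andP[lj jc]; case/eqP: jc.
by apply: (g_leaf lN lj); rewrite g_sym.
Qed.

Lemma yfun_sym i j : yfun adj a pW u i j = yfun adj a pW u j i.
Proof. by rewrite /yfun ap_sym u_sym [xv u i * _]mulrC. Qed.

Lemma yfun_star c l : c \in N -> g c l -> yfun adj a pW u c l = A c / xv u c.
Proof.
move=> cN cl; rewrite /yfun g_ap // (gt_eqF (A_gt0 cN cl)) (xv_leaf cN cl).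
by field; rewrite !gt_eqF ?u_gt0 ?(xv_gt0 cl).
Qed.

(** The total of a leaf is its only edge, so a star contributes A c from its nucleus and A c from
    its leaves, whatever the weights. Hence H is constant under perturbations inside [g], which is
    the key to the Jacobian. *)
Lemma sum_star : \sum_i \sum_(j | g i j) ap i j * u i j ^+ 2 / (xv u i * xv u j)
  = 2 * \sum_(c in N) A c.
Proof.
have half : \sum_(i in N) \sum_(j | g i j) ap i j * u i j ^+ 2 / (xv u i * xv u j)
    = \sum_(c in N) A c.
  apply: eq_bigr => c cN.
  have [/existsP[k ck]|/existsPn nk] := boolP [exists k, g c k]; last first.
    by rewrite A_isolated // big1 // => l cl; rewrite (negPf (nk l)) in cl.
  transitivity (\sum_(j | g c j) A c / xv u c * u c j).
    apply: eq_bigr => l cl; rewrite g_ap // (xv_leaf cN cl).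
    by field; rewrite !gt_eqF ?u_gt0 ?(xv_gt0 cl).
  by rewrite -mulr_sumr -xv_g divfK // gt_eqF ?(xv_gt0 ck).
have flip : \sum_(i | i \notin N) \sum_(j | g i j) ap i j * u i j ^+ 2 / (xv u i * xv u j)
    = \sum_(c in N) A c.
  rewrite -half (exchange_big_dep [in N]) /=.
    apply: eq_bigr => j jN; apply: eq_big => [i|i _]; last by rewrite ap_sym u_sym [xv u i * _]mulrC.
    rewrite g_sym andbC; case ji : (g j i) => //=.
    by rewrite -(g_bip ji).
  by move=> i j iN ij; rewrite (g_bip (_ : g j i)) // g_sym.
by rewrite (bigID [in N]) /= half flip mulr2n mulrDl mul1r.
Qed.

End Arrays.

(** * Edge coordinates *)

Notation Es := (Eset adj).

Lemma edgeP (k : 'I_#|Es|) : exists i j, [/\ ends k = Some (i, j), adj i j &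
  enum_val k = [set i; j]%SET :> {set V}].
Proof.
have : enum_val k \in Es by exact: enum_valP.
rewrite inE => /existsP[i /existsP[j /andP[ij /eqP e]]].
rewrite /ends e; case: pickP => [i'|/(_ i)]; last by rewrite !inE eqxx.
rewrite !inE => ii'; case: pickP => [j'|]; last first.
  move=> /(_ (if i' == i then j else i)); rewrite !inE.
  have nij : i != j by apply: contraTneq ij => ->; rewrite adj_irr.
  have nji : j != i by rewrite eq_sym.
  case: (eqVneq i' i) => [->|ne]; first by rewrite nji eqxx orbT.
  by rewrite (eq_sym i i') ne eqxx.
rewrite !inE => /andP[ji' jj']; exists i', j'.
have [[ei ej]|[ei ej]] : (i' = i /\ j' = j) \/ (i' = j /\ j' = i).
- by move: ii' ji' => /orP[] /eqP ->; case/orP: jj' => /eqP ->; rewrite ?eqxx //; auto.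
- by rewrite ei ej.
- by rewrite ei ej finset.setUC adj_sym.
Qed.

Lemma set2_inj i j i' j' : [set i; j]%SET = [set i'; j']%SET :> {set V} ->
  (i = i' /\ j = j') \/ (i = j' /\ j = i').
Proof.
move=> /setP e; have := e i; have := e j; have := e i'; have := e j'.
rewrite !inE !eqxx /= !orbT.
do ![case: eqP => // ?; subst]; rewrite ?eqxx //=; auto.
Qed.

Lemma edge_index i j : adj i j -> exists k : 'I_#|Es|, enum_val k = [set i; j]%SET.
Proof.
move=> ij; have ijE : [set i; j]%SET \in Es.
  by rewrite inE; apply/existsP; exists i; apply/existsP; exists j; rewrite ij eqxx.
by exists (enum_rank_in ijE [set i; j]%SET); rewrite enum_rankK_in.
Qed.

Lemma arr_of_edge (y : 'rV[R]_#|Es|) (k : 'I_#|Es|) i j : enum_val k = [set i; j]%SET ->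
  arr_of y i j = y 0 k.
Proof.
move=> e; rewrite /arr_of (bigD1 k) /=; last by rewrite e.
rewrite big1 ?addr0 // => k' /andP[/eqP e' /negP]; case; apply/eqP.
by apply: enum_val_inj; rewrite e e'.
Qed.

Lemma arr_of_nonedge (y : 'rV[R]_#|Es|) i j : ~~ adj i j -> arr_of y i j = 0.
Proof.
move=> nij; rewrite /arr_of big1 // => k /eqP e.
have [i' [j' [_ ij' e']]] := edgeP k; case/negP: nij; rewrite e in e'.
by have [[-> ->]//|[-> ->]] := set2_inj e'; rewrite adj_sym.
Qed.

Lemma arr_of_sym (y : 'rV[R]_#|Es|) i j : arr_of y i j = arr_of y j i.
Proof. by rewrite /arr_of finset.setUC. Qed.

Lemma xv_arr_of (y : 'rV[R]_#|Es|) i :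
  xv (arr_of y) i = \sum_k y 0 k * (i \in (enum_val k : {set V}))%:R.
Proof.
rewrite /xv /arr_of.
under eq_bigr do rewrite big_mkcond.
rewrite exchange_big /=; apply: eq_bigr => k _.
have [u [v [_ uv ->]]] := edgeP k.
have nuv : u != v by apply: contraTneq uv => ->; rewrite adj_irr.
rewrite !inE -big_mkcond /=.
have [->|iu] := eqVneq i u.
  rewrite (bigD1 v) //= big1 ?addr0 ?mulr1 // => j /andP[/eqP e jv].
  by have [[_ e1]|[_ e1]] := set2_inj e; [move: jv; rewrite e1 eqxx|move: nuv; rewrite e1 eqxx].
have [->|iv] := eqVneq i v.
  rewrite (bigD1 u) /=; last by rewrite finset.setUC.
  rewrite big1 ?addr0 ?mulr1 // => j /andP[/eqP e ju].
  have [[e1 _]|[e1 _]] := set2_inj e; first by move: nuv; rewrite e1 eqxx.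
  by move: ju; rewrite e1 eqxx.
rewrite mulr0 big1 // => j /eqP e.
have [[e1 _]|[_ e1]] := set2_inj e; first by move: iu; rewrite e1 eqxx.
by move: iv; rewrite e1 eqxx.
Qed.

Section Stability.
Variable x : V -> V -> R.
Hypothesis x_sym : forall i j, x i j = x j i.
Hypothesis x_off : forall i j, ~~ g i j -> x i j = 0.
Hypothesis x_gt0 : forall i j, g i j -> 0 < x i j.
Hypothesis A_isolated : forall c, (forall l, ~~ g c l) -> A c = 0.

Let H0 := 2 * \sum_(c in N) A c.
Hypothesis x_eq : forall c l, c \in N -> g c l -> A c / xv x c = H0.

Let y0 := edge_coords adj x.

Lemma edge_coords_val (k : 'I_#|Es|) i j : enum_val k = [set i; j]%SET -> y0 0 k = x i j.
Proof.
move=> e; rewrite /y0 /edge_coords mxE; have [i' [j' [-> _ e']]] := edgeP k.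
by rewrite e in e'; have [[-> ->]//|[-> ->]] := set2_inj e'.
Qed.

Lemma arr_of_edge_coords : arr_of y0 = x.
Proof.
apply/funext => i; apply/funext => j; have [ij|nij] := boolP (adj i j).
  by have [k e] := edge_index ij; rewrite (arr_of_edge _ e) (edge_coords_val e).
by rewrite arr_of_nonedge // x_off //; apply: contra nij; exact: g_sub.
Qed.

Let ray (l : 'I_#|Es|) (t : R) : 'rV[R]_#|Es| := t *: delta_mx 0 l + y0.

Lemma rayE l t k : ray l t 0 k = y0 0 k + t * (k == l)%:R.
Proof. by rewrite !mxE /= addrC. Qed.

Lemma arr_ray l t i j :
  arr_of (ray l t) i j = x i j + t * (enum_val l == [set i; j]%SET)%:R.
Proof.
have [ij|nij] := boolP (adj i j).
  have [k e] := edge_index ij; rewrite (arr_of_edge _ e) rayE (edge_coords_val e).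
  by rewrite -e (inj_eq enum_val_inj) eq_sym.
rewrite arr_of_nonedge // x_off ?add0r; last by apply: contra nij; exact: g_sub.
case: eqP => [e|]; last by rewrite mulr0.
have [i' [j' [_ ij' e']]] := edgeP l; rewrite e in e'; case/negP: nij.
by have [[-> ->]//|[-> ->]] := set2_inj e'; rewrite adj_sym.
Qed.

Lemma xv_ray l t i : xv (arr_of (ray l t)) i = xv x i + t * (i \in (enum_val l : {set V}))%:R.
Proof.
have -> : xv x i = \sum_k y0 0 k * (i \in (enum_val k : {set V}))%:R.
  by rewrite -[in LHS]arr_of_edge_coords xv_arr_of.
rewrite xv_arr_of; under eq_bigr do rewrite rayE mulrDl.
rewrite big_split /=; congr (_ + _); rewrite (bigD1 l) //= eqxx mulr1 big1 ?addr0 //.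
by move=> k /negPf ->; rewrite mulr0 mul0r.
Qed.

Definition gedge (k : 'I_#|Es|) := [exists i, exists j, g i j && (enum_val k == [set i; j]%SET)].

Lemma gedgeE (k : 'I_#|Es|) i j : enum_val k = [set i; j]%SET -> gedge k = g i j.
Proof.
move=> e; apply/existsP/idP => [[i' /existsP[j' /andP[ij' /eqP]]]|ij].
  by rewrite e => e'; have [[-> ->]//|[-> ->]] := set2_inj e'; rewrite g_sym.
by exists i; apply/existsP; exists j; rewrite ij e eqxx.
Qed.

(** Each partial derivative is computed by exhibiting the difference quotient near 0 as an explicit
    function continuous at 0. *)
Lemma Jac_lim k l (G : R -> R) : {for 0, continuous G} ->
  (\forall t \near 0^', t^-1 * (Fedge a pW (ray l t) k - Fedge a pW y0 k) = G t) ->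
  Jac adj a pW x k l = G 0.
Proof.
move=> cG FG; rewrite mxE /derive; apply: cvg_lim => //.
apply: cvg_trans (near_eq_cvg _) _; last exact/continuous_withinNx/cG.
by near=> t; rewrite -(near FG t).
Unshelve. all: by end_near. Qed.
Lemma H0_ge0 : 0 <= H0.
Proof.
rewrite mulr_ge0 // sumr_ge0 // => c cN.
have [/existsP[k ck]|/existsPn nk] := boolP [exists k, g c k]; last by rewrite A_isolated.
exact: ltW (A_gt0 cN ck).
Qed.

Lemma Fsmooth_sym u i j : (forall i j, u i j = u j i) ->
  Fsmooth adj a pW u i j = Fsmooth adj a pW u j i.
Proof. by move=> us; rewrite /Fsmooth yfun_sym // us. Qed.

Lemma FedgeE (y : 'rV[R]_#|Es|) (k : 'I_#|Es|) i j : enum_val k = [set i; j]%SET ->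
  Fedge a pW y k = Fsmooth adj a pW (arr_of y) i j.
Proof.
move=> e; rewrite /Fedge; have [i' [j' [-> _ e']]] := edgeP k; rewrite e in e'.
have [[-> ->]//|[-> ->]] := set2_inj e'.
by apply: Fsmooth_sym => p q; exact: arr_of_sym.
Qed.

Lemma Hsmooth_star u : (forall i j, u i j = u j i) -> (forall i j, ~~ g i j -> u i j = 0) ->
  (forall i j, g i j -> 0 < u i j) -> Hsmooth adj a pW u = H0.
Proof.
move=> us uo u0; rewrite /H0 -(sum_star us uo u0 A_isolated); apply: eq_bigr => i _.
rewrite big_mkcond [RHS]big_mkcond; apply: eq_bigr => j _.
case gij : (g i j); first by rewrite ap_pos_g.
by case: ifP => // _; rewrite uo ?gij // expr0n mulr0 mul0r.
Qed.

Lemma Fedge_y0 k : Fedge a pW y0 k = 0.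
Proof.
have [i [j [_ ij e]]] := edgeP k; rewrite (FedgeE _ e) arr_of_edge_coords /Fsmooth.
have [gij|gij] := boolP (g i j); last by rewrite x_off // mul0r.
rewrite Hsmooth_star //; have [iN|iN] := boolP (i \in N).
  by rewrite yfun_star // (x_eq iN gij) subrr mulr0.
have jN : j \in N by rewrite -[j \in N]negbK -(g_bip gij).
have gji : g j i by rewrite g_sym.
by rewrite yfun_sym // yfun_star // (x_eq jN gji) subrr mulr0.
Qed.

(** F_k = x_k (y_k - H) with x_k = 0: along another coordinate F_k stays 0, and along its own the
    quotient is y_k - H, which tends to -H0 since y_k vanishes at x. *)
Lemma Jac_off k l : ~~ gedge k -> Jac adj a pW x k l = - H0 * (k == l)%:R.
Proof.
have [i [j [_ ij e]]] := edgeP k; rewrite (gedgeE e) => nij.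
have [<-|kl] := eqVneq k l; last first.
  rewrite mulr0; apply: (@Jac_lim k l (cst 0)); first exact: cvg_cst.
  near=> t; rewrite Fedge_y0 subr0 (FedgeE _ e) /Fsmooth arr_ray x_off // -e.
  by rewrite (inj_eq enum_val_inj) eq_sym (negPf kl) mulr0 addr0 mul0r mulr0.
pose u t := arr_of (ray k t).
pose G t := yfun adj a pW (u t) i j - Hsmooth adj a pW (u t).
have uE t p q : u t p q = x p q + t * (enum_val k == [set p; q]%SET)%:R by exact: arr_ray.
have u0 : u 0 = x.
  by apply/funext => p; apply/funext => q; rewrite uE mul0r addr0.
have xvE t p : xv (u t) p = xv x p + t * (p \in (enum_val k : {set V}))%:R by exact: xv_ray.
rewrite mulr1 (_ : - H0 = G 0); last first.
  rewrite /G u0 Hsmooth_star // /yfun x_off // mulr0 mul0r.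
  by case: ifP => _; rewrite add0r.
apply: Jac_lim; last first.
  near=> t; have t0 : t != 0 by near: t; exact: nbhs_dnbhs_neq.
  rewrite Fedge_y0 subr0 (FedgeE _ e) /Fsmooth -/(u t) [X in _ * (X * _)]uE.
  by rewrite x_off // -e eqxx mulr1 add0r mulrA mulVf // mul1r.
have cx p : {for 0, continuous (fun t => xv (u t) p)}.
  rewrite (_ : (fun t => _) = (fun t => xv x p + t * (p \in (enum_val k : {set V}))%:R)).
    exact: continuous_affine.
  by apply/funext => t; rewrite xvE.
(* By [ap_cover] both vertices lie on edges of [g], so the denominators do not vanish at t = 0. *)
have cxv p q : 0 < ap p q -> {for 0, continuous (fun t => xv (u t) p * xv (u t) q)} /\
    xv (u 0) p * xv (u 0) q != 0.
  move=> pq; split.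
    by apply: continuous_prod2.
  have [p' pp'] := ap_cover pq; have [q' qq'] : exists k, g q k.
    by apply: (ap_cover (j := p)); rewrite ap_sym.
  by rewrite u0 mulf_neq0 // gt_eqF // (xv_gt0 x_off x_gt0 pp', xv_gt0 x_off x_gt0 qq').
have cu p q : {for 0, continuous (fun t => u t p q)}.
  rewrite (_ : (fun t => _) = (fun t => x p q + t * (enum_val k == [set p; q]%SET)%:R)).
    exact: continuous_affine.
  by apply/funext => t; rewrite uE.
have capu p q : {for 0, continuous (fun t => ap p q * u t p q)}.
  exact: (@continuous_prod2 _ (cst (ap p q)) (fun t => u t p q) _ (@cvg_cst _ _ _ _ _) (cu p q)).
apply: (@cvgB _ _ _ _ _ (fun t => yfun adj a pW (u t) i j) (fun t => Hsmooth adj a pW (u t))).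
  rewrite /yfun; case: eqP => [_|/eqP ap0]; first exact: cvg_cst.
  have ap1 : 0 < ap i j by rewrite lt_def ap0 mulr_ge0 // pij_ge0.
  have [c1 c2] := cxv i j ap1.
  exact: (@continuous_quot _ (fun t => ap i j * u t i j) (fun t => xv (u t) i * xv (u t) j)).
apply: cvg_finsum => p _; apply: cvg_finsum => q pq.
have [c1 c2] := cxv p q pq.
apply: (@continuous_quot _ (fun t => ap p q * u t p q ^+ 2) (fun t => xv (u t) p * xv (u t) q)) => //.
apply: (@continuous_prod2 _ (cst (ap p q)) (fun t => u t p q ^+ 2)); first exact: cvg_cst.
exact: continuous_prod2 (cu p q) (cu p q).
Unshelve. all: by end_near. Qed.

(** Moving along an edge of [g] preserves the stars, so H stays H0 by [sum_star] and y = A c / x_c.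
    As A c = H0 x_c at the equilibrium, the difference quotient is an explicit rational function of
    t. *)
Lemma Jac_on (k l : 'I_#|Es|) c j : c \in N -> g c j -> enum_val k = [set c; j]%SET ->
  gedge l -> Jac adj a pW x k l =
    - (x c j * H0 / xv x c) * (c \in (enum_val l : {set V}))%:R.
Proof.
move=> cN cj e gl.
set d : R := (c \in _)%:R; pose b : R := (enum_val l == [set c; j]%SET)%:R.
have xc0 := xv_gt0 x_off x_gt0 cj.
pose G t := - ((x c j + t * b) * H0 * d / (xv x c + t * d)).
rewrite (_ : - _ * d = G 0); last first.
  by rewrite /G !mul0r !addr0 mulNr mulrAC.
apply: Jac_lim.
  apply: (@cvgN _ _ _ _ _ (fun t => (x c j + t * b) * H0 * d / (xv x c + t * d))).
  apply: (@continuous_quot _ (fun t => (x c j + t * b) * H0 * d) (fun t => xv x c + t * d)).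
  - by rewrite mul0r addr0 gt_eqF.
  - rewrite (_ : (fun t => _) = (fun t => x c j * H0 * d + t * (b * H0 * d))).
      exact: continuous_affine.
    by apply/funext => t; ring.
  - exact: continuous_affine.
(* For |t| < e1 the perturbed array remains positive on [g]. *)
have [e1 e10 e1x] : exists2 e1, 0 < e1 & forall p : V * V, g p.1 p.2 -> e1 <= x p.1 p.2.
  by apply: pos_lower_bound => p; exact: x_gt0.
near=> t.
have t0 : t != 0 by near: t; exact: nbhs_dnbhs_neq.
have te : `|t| < e1 by near: t; exact: dnbhs0_lt.
pose u := arr_of (ray l t).
have uE p q : u p q = x p q + t * (enum_val l == [set p; q]%SET)%:R by exact: arr_ray.
have us p q : u p q = u q p by exact: arr_of_sym.
have uo p q : ~~ g p q -> u p q = 0.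
  move=> npq; rewrite uE x_off // add0r; case: eqP => [el|_]; last by rewrite mulr0.
  by rewrite (gedgeE el) (negPf npq) in gl.
have u0 p q : g p q -> 0 < u p q.
  move=> pq; rewrite uE; have := e1x (p, q) pq; move: te; rewrite ltr_norml => /andP[t1 t2] /= xe.
  by case: (_ == _); rewrite ?mulr1 ?mulr0; lra.
rewrite Fedge_y0 subr0 (FedgeE _ e) /Fsmooth -/u Hsmooth_star // yfun_star //.
have -> : A c = H0 * xv x c by rewrite -(x_eq cN cj) divfK // gt_eqF.
have uc : xv u c = xv x c + t * d by exact: xv_ray.
have uc0 := xv_gt0 uo u0 cj.
rewrite uc in uc0 *; rewrite uE -/b /G.
by field; rewrite t0 gt_eqF.
Unshelve. all: by end_near. Qed.

Lemma gedge_center k : exists c, gedge k -> c \in N /\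
   exists j, g c j /\ enum_val k = [set c; j]%SET.
Proof.
have [i [j [_ ij e]]] := edgeP k; have [iN|iN] := boolP (i \in N).
  by exists i; rewrite (gedgeE e) => gij; split=> //; exists j.
exists j; rewrite (gedgeE e) => gij; rewrite -[j \in N]negbK -(g_bip gij); split=> //.
by exists i; rewrite g_sym finset.setUC.
Qed.

(* Left eigenvectors are used because the columns of edges of g vanish on the rows of the
   other edges; the entries with row in g and column off g are never needed. *)
Lemma Jac_spectrum (z : R[i]) :
  root (map_poly (real_complex R) (char_poly (Jac adj a pW x))) z -> complex.Re z <= 0.
Proof.
rewrite map_char_poly -eigenvalue_root_char => /eigenvalueP[v vJ v_neq0].
have [->|z0] := eqVneq z 0; first by [].
have [->|zH] := eqVneq z (- real_complex R H0); first by rewrite /= oppr_le0 H0_ge0.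
pose H := real_complex R H0.
have col l : \sum_k v 0 k * real_complex R (Jac adj a pW x k l) = z * v 0 l.
  move/matrixP: vJ => /(_ 0 l); rewrite [RHS]mxE => <-.
  by rewrite mxE; apply: eq_bigr => k _; rewrite [in RHS]mxE.
have [cen Hcen] := choice gedge_center.
pose coef k : R := y0 0 k / xv x (cen k).
have inN k l : gedge k -> gedge l -> (cen k \in (enum_val l : {set V})) = (cen k == cen l).
  move=> gk gl; have [ckN _] := Hcen k gk; have [clN [j [cj ->]]] := Hcen l gl.
  rewrite !inE; have [kj|] := eqVneq (cen k) j; last by rewrite orbF.
  by move: clN; rewrite (g_bip cj) -kj ckN.
pose w c := \sum_(k | gedge k && (cen k == c)) v 0 k * real_complex R (coef k).
have colg l : gedge l -> z * v 0 l = - H * w (cen l).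
  move=> gl; rewrite -col (bigID gedge) /= [X in _ + X]big1 ?addr0; last first.
    move=> k gk; rewrite Jac_off //; case: eqP => [kl|_]; first by rewrite kl gl in gk.
    by rewrite mulr0 rmorph0 mulr0.
  rewrite /w mulr_sumr [RHS]big_mkcondr; apply: eq_bigr => k gk.
  have [ckN [j [cj e]]] := Hcen k gk.
  rewrite (Jac_on ckN cj e gl) inN // -(edge_coords_val e).
  case: eqP => _; last by rewrite mulr0 rmorph0 mulr0.
  have -> : y0 0 k * H0 / xv x (cen k) = coef k * H0 by rewrite /coef mulrAC.
  rewrite mulr1 rmorphN rmorphM mulrN mulNr mulrA; congr (- _).
  by rewrite [RHS]mulrC.
have coef_sum l : gedge l -> \sum_(k | gedge k && (cen k == cen l)) coef k = 1.
  move=> gl; have [clN [j [cj _]]] := Hcen l gl.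
  have -> : \sum_(k | gedge k && (cen k == cen l)) coef k =
      (\sum_(k | gedge k && (cen k == cen l)) y0 0 k) / xv x (cen l).
    by rewrite mulr_suml; apply: eq_bigr => k /andP[_ /eqP <-].
  suff -> : \sum_(k | gedge k && (cen k == cen l)) y0 0 k = xv x (cen l).
    by rewrite divff // gt_eqF // (xv_gt0 x_off x_gt0 cj).
  rewrite -[in RHS]arr_of_edge_coords xv_arr_of big_mkcond; apply: eq_bigr => k _.
  have [gk|gk] /= := boolP (gedge k).
    rewrite eq_sym -(inN l k) //; by case: ifP => _; rewrite ?mulr1 ?mulr0.
  have [p [q [_ _ e]]] := edgeP k; rewrite (edge_coords_val e) x_off ?mul0r //.
  by rewrite -(gedgeE e).
(* Summing the columns of a star against the shares, whose sum is 1, gives z w = -H w, and z differs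
   from -H. *)
have w0 l : gedge l -> w (cen l) = 0.
  move=> gl; have zw : z * w (cen l) = - H * w (cen l).
    rewrite -[RHS]mulr1 -[1](rmorph1 (real_complex R)) -(coef_sum l gl) rmorph_sum [RHS]mulr_sumr.
    rewrite /w mulr_sumr; apply: eq_bigr => k /andP[gk /eqP ck].
    by rewrite mulrA colg // ck.
  have /eqP : (z + H) * w (cen l) = 0 by rewrite mulrDl zw mulNr addNr.
  by rewrite mulf_eq0 addr_eq0 (negPf zH) => /eqP.
have vg l : gedge l -> v 0 l = 0.
  move=> gl; have /eqP := colg l gl; rewrite w0 // mulr0 mulf_eq0 (negPf z0) => /eqP //.
(* As [v] vanishes on the edges of [g], the column of any other edge reduces to its diagonal entry
   -H, so [v] vanishes there too. *)
exfalso; move/eqP: v_neq0; apply; apply/rowP => l; rewrite [RHS]mxE.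
have [gl|gl] := boolP (gedge l); first exact: vg.
have := col l; rewrite (bigD1 l) //= Jac_off // eqxx mulr1 big1 ?addr0; last first.
  move=> k kl; have [gk|gk] := boolP (gedge k); first by rewrite vg // mul0r.
  by rewrite Jac_off // (negPf kl) mulr0 rmorph0 mulr0.
rewrite rmorphN => /eqP; rewrite -subr_eq0 mulrC -mulrBl mulf_eq0 => /orP[|/eqP //].
by rewrite subr_eq0 eq_sym (negPf zH).
Qed.
End Stability.

(** * Conclusion *)

Section Conclusion.
Variable x : V -> V -> R.
Hypothesis x_sym : forall i j, x i j = x j i.
Hypothesis x_off : forall i j, ~~ g i j -> x i j = 0.
Hypothesis x_gt0 : forall i j, g i j -> 0 < x i j.
Hypothesis x_sum : \sum_i \sum_j x i j = 1.
Hypothesis A_isolated : forall c, (forall l, ~~ g c l) -> A c = 0.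
Hypothesis x_eq : forall c l, c \in N -> g c l -> A c / xv x c = 2 * \sum_(c in N) A c.

Lemma equilibrium_in_Delta : in_Delta adj a pW v0 x.
Proof.
split=> //; [by move=> i j; exact: array_ge0| |].
  by move=> i j nij; rewrite x_off //; apply: contra nij; exact: g_sub.
have -> : \sum_i \sum_(j | 0 < ap i j) x i j = 1.
  rewrite -x_sum; apply: eq_bigr => i _; rewrite [RHS](bigID (fun j => 0 < ap i j)) /=.
  rewrite [X in _ + X]big1 ?addr0 // => j nap; apply: x_off; apply: contra nap.
  exact: ap_pos_g.
rewrite /h1; set num := \sum_i _; set den := \sum_k _.
have nd : num <= den.
  apply: ler_sum => i _; rewrite [leRHS](bigID (fun j => 0 < ap i j)) /= lerDl.
  exact: sumr_ge0.
have : 0 <= den by apply: sumr_ge0 => i _; exact: sumr_ge0.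
(* A zero denominator would give [h1] = 0, the inverse of 0 being 0. *)
rewrite le_eqVlt => /orP[/eqP <-|d0]; first by rewrite invr0 mulr0 ler01.
by rewrite ler_pdivrMr // mul1r.
Qed.

Lemma equilibrium_stable : stable_eq adj a pW v0 x.
Proof.
have xGe0 i j : (0 < x i j) = g i j.
  by have [/x_gt0|/x_off ->] := boolP (g i j); rewrite ?ltxx.
have HH : Hfun adj a pW x = 2 * \sum_(c in N) A c.
  rewrite -(sum_star x_sym x_off x_gt0 A_isolated); apply: eq_bigr => i _.
  by apply: eq_bigl => j; exact: xGe0.
split.
- split; first exact: equilibrium_in_Delta.
  move=> i j; rewrite /Ffun; case: eqP => // /eqP xij.
  have gij : g i j by apply: contraNT xij => /x_off ->.
  rewrite HH; have [iN|iN] := boolP (i \in N).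
    by rewrite yfun_star // (x_eq iN gij) subrr mulr0.
  have jN : j \in N by rewrite -[j \in N]negbK -(g_bip gij).
  have gji : g j i by rewrite g_sym.
  by rewrite yfun_sym // yfun_star // (x_eq jN gji) subrr mulr0.
- move=> [_ [i [[j [_ apij]]]]]; have [k ik] := ap_cover apij.
  rewrite (bigD1 k) /=; last exact: ap_pos_g.
  move/eqP; apply/negP; rewrite gt_eqF // ltr_pwDl ?x_gt0 // sumr_ge0 // => l _.
  exact: array_ge0.
- move=> y; exact: Jac_spectrum.
Qed.

End Conclusion.

Lemma sum_flip (u : V -> V -> R) : (forall i j, u i j = u j i) ->
  (forall i j, ~~ g i j -> u i j = 0) ->
  \sum_i \sum_j u i j = 2 * \sum_(c in N) \sum_(l | g c l) u c l.
Proof.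
move=> us uo.
have ug i : \sum_j u i j = \sum_(j | g i j) u i j.
  by rewrite (bigID (g i)) /= [X in _ + X]big1 ?addr0 // => j; exact: uo.
under eq_bigr do rewrite ug.
have flip : \sum_(i | i \notin N) \sum_(j | g i j) u i j =
    \sum_(i in N) \sum_(j | g i j) u i j.
  rewrite (exchange_big_dep [in N]) /=.
    apply: eq_bigr => j jN; apply: eq_big => [i|i _]; last exact: us.
    rewrite g_sym andbC; case ji : (g j i) => //=.
    by rewrite -(g_bip ji).
  by move=> i j iN ij; rewrite (g_bip (_ : g j i)) // g_sym.
by rewrite (bigID [in N]) /= flip mulr2n mulrDl mul1r.
Qed.

(** * The limit of the normalized process *)

Section LimitState.
Variables (z : V -> V -> R) (ep ka : R) (n0 k0 : nat) (h : nat -> step V).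
Hypothesis ep_gt0 : 0 < ep.
Hypothesis ep_lt : forall c l, c \in N -> g c l -> ep < z c l.
Hypothesis ka_gt0 : 0 < ka.
Hypothesis k0_gt0 : (0 < k0)%N.
Hypothesis Phi_lt1 : forall n, (n0 <= n)%N -> Phi z ep ka n0 (16 ^ k0) n h < 1.
Hypothesis hok : forall k, admissible (h k).
Hypothesis A_isolated : forall c, (forall l, ~~ g c l) -> A c = 0.
Hypothesis A_sum : 0 < \sum_(c in N) A c.

Let m n : R := (clk n0 (16 ^ k0) n)%:R.
Let H0 := 2 * \sum_(c in N) A c.

Lemma limit_ratios : exists y : V -> V -> R, forall c l, c \in N -> g c l ->
  (fun n => ratio g c (Vproc h n) l) @ \oo --> y c l /\ `|y c l - z c l| <= ep.
Proof.
have H (p : V * V) : exists y, p.1 \in N -> g p.1 p.2 ->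
    (fun n => ratio g p.1 (Vproc h n) p.2) @ \oo --> y /\ `|y - z p.1 p.2| <= ep.
  have [/andP[cN cl]|ncl] := boolP ((p.1 \in N) && g p.1 p.2); last first.
    by exists 0 => cN cl; rewrite cN cl in ncl.
  by have [y y1 y2] := ratio_cvg ep_gt0 ka_gt0 Phi_lt1 cN cl; exists y.
have [f Hf] := choice H.
by exists (fun c l => f (c, l)) => c l cN cl; exact: (Hf (c, l)).
Qed.

(** Everything is measured against the clock: an edge of [g] grows like Z_cl S_c, hence at rate y A
    c, and the total weight at rate H0, each star being counted from both ends. The rate is positive
    because [ep] < z keeps y positive, so the weights on [g] diverge. *)
Theorem limit_state : exists (y x : V -> V -> R),
  [/\ (forall i j, x i j = x j i) /\ (forall i j, ~~ g i j -> x i j = 0),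
      forall c l, c \in N -> g c l -> [/\ x c l = y c l * A c / H0, 0 < y c l & `|y c l - z c l| <= ep],
      forall c l, c \in N -> g c l -> xv x c = A c / H0,
      \sum_i \sum_j x i j = 1 &
   (forall i j, (fun n => xproc adj a v0 h n i j) @ \oo --> x i j) /\
   (forall i j, (fun n => Vproc h n i j) @ \oo --> +oo <-> g i j)].
Proof.
have H00 : 0 < H0 by rewrite mulr_gt0.
have [y Hy] := limit_ratios.
have y0 c l : c \in N -> g c l -> 0 < y c l.
  move=> cN cl; have [_] := Hy c l cN cl; have := ep_lt cN cl.
  by rewrite ler_norml => + /andP[+ _]; lra.
(* Limit of the weight divided by the clock; the inner test reads the edge from its nucleus and
   makes L symmetric. *)
pose L i j := if g i j then (if i \in N then y i j * A i else y j i * A j) else 0.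
have Lg c l : c \in N -> g c l -> L c l = y c l * A c by rewrite /L => -> ->.
have Lsym i j : L i j = L j i.
  rewrite /L g_sym; case ij : (g j i) => //.
  by rewrite (g_bip ij); case: (i \in N).
have Loff i j : ~~ g i j -> L i j = 0 by rewrite /L => /negPf ->.
have L0 i j : g i j -> 0 < L i j.
  move=> ij; have [iN|iN] := boolP (i \in N).
    by rewrite Lg // mulr_gt0 ?y0 // (A_gt0 iN ij).
  have jN : j \in N by rewrite -[j \in N]negbK -(g_bip ij).
  have ji : g j i by rewrite g_sym.
  by rewrite Lsym Lg // mulr_gt0 ?y0 // (A_gt0 jN ji).
have ysum c l : c \in N -> g c l -> \sum_(k | g c k) y c k = 1.
  move=> cN cl.
  have cs : (fun n => \sum_(k | g c k) ratio g c (Vproc h n) k) @ \oo --> \sum_(k | g c k) y c k.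
    by apply: cvg_finsum => k ck; case: (Hy c k cN ck).
  apply: (cvg_unique _ cs) => //.
  rewrite (_ : (fun n => _) = cst 1); first exact: cvg_cst.
  by apply/funext => n; rewrite /ratio ratio_sum // (hub_gt0 h n cl).
have Lsum : \sum_i \sum_j L i j = H0.
  rewrite sum_flip //; congr (_ * _); apply: eq_bigr => c cN.
  have [/existsP[k ck]|/existsPn nk] := boolP [exists k, g c k]; last first.
    by rewrite A_isolated // big1 // => l cl; rewrite (negPf (nk l)) in cl.
  transitivity (\sum_(l | g c l) y c l * A c); first by apply: eq_bigr => l cl; rewrite Lg.
  by rewrite -mulr_suml (ysum c k) // mul1r.
have m_large (r : R) : \forall n \near \oo, r <= m n.
  by have := clk_large n0 k0 r; apply: filterS => n [].
have m0 n : 0 < m n.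
  by rewrite /m ltr0n /clk addn_gt0 expn_gt0 orbT.
have minv : (fun n => (m n)^-1) @ \oo --> (0 : R).
  apply/cvgrPdist_le => e e0; near=> n.
  have en : e^-1 <= m n by near: n; exact: m_large.
  by rewrite sub0r normrN normfV (gtr0_norm (m0 n)) -[leRHS]invrK lef_pV2 ?posrE ?invr_gt0.
have VL i j : (fun n => Vproc h n i j / m n) @ \oo --> L i j.
  have onN c l : c \in N -> g c l -> (fun n => Vproc h n c l / m n) @ \oo --> L c l.
    move=> cN cl; rewrite Lg //.
    rewrite (_ : (fun n => _) = (fun n => ratio g c (Vproc h n) l) \*
        (fun n => hub g c (Vproc h n) / m n)); last first.
      by apply/funext => n /=; rewrite /ratio mulrA divfK // gt_eqF // (hub_gt0 h n cl).
    apply: cvgM; first by case: (Hy c l cN cl).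
    exact: (hub_rate ka_gt0 k0_gt0 Phi_lt1 cN cl).
  have [ij|nij] := boolP (g i j); last first.
    rewrite Loff // (_ : (fun n => _) = cst (v0 i j) \* (fun n => (m n)^-1)); last first.
      by apply/funext => n /=; rewrite Vproc_off.
    by rewrite -(mulr0 (v0 i j)); apply: cvgM => //; exact: cvg_cst.
  have [iN|iN] := boolP (i \in N); first exact: onN.
  have jN : j \in N by rewrite -[j \in N]negbK -(g_bip ij).
  rewrite Lsym (_ : (fun n => _) = (fun n => Vproc h n j i / m n)).
    by apply: onN => //; rewrite g_sym.
  by apply/funext => n; rewrite Vproc_sym.
have TL : (fun n => Tproc adj a v0 h n / m n) @ \oo --> H0.
  rewrite -Lsum (_ : (fun n => _) = (fun n => \sum_i \sum_j Vproc h n i j / m n)).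
    by apply: cvg_finsum => i _; apply: cvg_finsum => j _; exact: VL.
  apply/funext => n; rewrite /Tproc mulr_suml; apply: eq_bigr => i _.
  by rewrite mulr_suml.
exists y, (fun i j => L i j / H0); split.
- split=> i j; first by rewrite Lsym.
  by move=> nij; rewrite Loff // mul0r.
- move=> c l cN cl; rewrite Lg //; split => //; first exact: y0.
  by case: (Hy c l cN cl).
- move=> c l cN cl; rewrite /xv -mulr_suml; congr (_ / _).
  rewrite (bigID (g c)) /= [X in _ + X]big1 ?addr0 => [|k]; last exact: Loff.
  transitivity (\sum_(k | g c k) y c k * A c); first by apply: eq_bigr => k ck; rewrite Lg.
  by rewrite -mulr_suml (ysum c l) // mul1r.
- under eq_bigr do rewrite -mulr_suml.
  by rewrite -mulr_suml Lsum divff // gt_eqF.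
split=> i j.
  rewrite (_ : (fun n => _) = (fun n => (Vproc h n i j / m n)) \*
      (fun n => (Tproc adj a v0 h n / m n)^-1)); last first.
    apply/funext => n /=; rewrite /xproc invf_div mulrA divfK //.
    by rewrite gt_eqF.
  by apply: cvgM => //; apply: cvgV => //; rewrite gt_eqF.
split=> [Vinf|ij].
  apply: contrapT => /negP nij.
  have [n] : exists n, v0 i j + 1 <= Vproc h n i j.
    by move/cvgryPge: Vinf => /(_ (v0 i j + 1))/filter_ex.
  by rewrite Vproc_off // gerDl ler10.
apply/cvgryPge => r.
have l2 : L i j / 2 < L i j by have := L0 i j ij; lra.
near=> n.
have h1 : L i j / 2 <= Vproc h n i j / m n.
  by near: n; apply: (cvgr_ge (L i j)) => //; exact: VL.
have h2 : r / (L i j / 2) <= m n by near: n; exact: m_large.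
have l0 : 0 < L i j / 2 by rewrite divr_gt0 ?L0.
rewrite ler_pdivrMr // in h2; rewrite ler_pdivlMr // in h1.
by apply: le_trans h2 _; rewrite mulrC.
Unshelve. all: by end_near. Qed.

End LimitState.

End Network.

(** A vertex with two neighbours is the nucleus of its component, so a vertex outside [N] has at
    most one. Were both ends of an edge outside [N], they would form a whole component, which would
    lack a nucleus. *)
Lemma nuclei_star (V : finType) (g : rel V) (N : {set V}) :
  symmetric g -> irreflexive g -> nuclei g N ->
  (forall i j, g i j -> (i \in N) = (j \notin N)) /\
  (forall l c c', l \notin N -> g l c -> g l c' -> c = c').
Proof.
move=> gs gi [N1 N2 N3].
have cs : connect_sym g by apply: sym_connect_sym.
have many l c c' : c != c' -> g l c -> g l c' -> (1 < #|nbrs g l|)%N.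
  move=> cc lc lc'; rewrite -(_ : #|[set c; c']%SET| = 2)%N; last by rewrite cards2 cc.
  by apply: subset_leq_card; apply/fintype.subsetP => u; rewrite !inE => /orP[] /eqP ->.
have leaf l c c' : l \notin N -> g l c -> g l c' -> c = c'.
  move=> lN lc lc'; apply/eqP; apply: contraNT lN => cc.
  have [k kN lk] := N1 l; rewrite (N3 k l kN) // 1?cs //.
  exact: many cc lc lc'.
split=> // i j ij; have [iN|iN] := boolP (i \in N).
  apply/esym/negP => jN; have e := N2 i j iN jN (connect1 ij).
  by rewrite e gi in ij.
apply/esym/negbTE; rewrite negbK; apply: contraT => jN.
have [k kN ik] := N1 i.
have cl : closed_mem g (mem [pred u | (u == i) || (u == j)]).
  apply: intro_closed => // u w uw; rewrite !inE => /orP[/eqP eu|/eqP eu]; subst u.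
    by rewrite (leaf i w j) // eqxx orbT.
  by rewrite (leaf j w i) ?eqxx // gs.
have := closed_connect cl ik; rewrite !inE eqxx /= => /esym /orP[/eqP e|/eqP e].
  by rewrite -e kN in iN.
by rewrite -e kN in jN.
Qed.

Theorem theorem3
  (R : realType) (V : finType) (adj : rel V)
  (adj_sym : symmetric adj) (adj_irr : irreflexive adj)
  (a : V -> V -> R)
  (a_sym : forall i j, a i j = a j i) (a_ge0 : forall i j, 0 <= a i j)
  (a_adj : forall i j, 0 < a i j -> adj i j)
  (pW : {set V} -> R)
  (pW_ge0 : forall W, 0 <= pW W) (pW_sum : \sum_(W : {set V}) pW W = 1)
  (ap_pos : exists i j, 0 < ap adj a pW i j)
  (v0 : V -> V -> R)
  (v0_sym : forall i j, v0 i j = v0 j i) (v0_ge0 : forall i j, 0 <= v0 i j)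
  (v0_pos : forall i j, 0 < v0 i j <-> adj i j)
  (g : rel V) (g_sym : symmetric g) (g_sub : forall i j, g i j -> adj i j)
  (HPG : P_G adj a pW g)
  (q : V -> V -> R) (Hq : in_Gamma_G adj a pW v0 g q)
  (Nq : (V -> V -> R) -> Prop)
  (Nq_sub : forall x, Nq x -> in_Gamma_G adj a pW v0 g x)
  (Nq_nbhd : exists2 eps : R, 0 < eps &
     forall x, in_Gamma_G adj a pW v0 g x ->
       (forall i j, `|x i j - q i j| < eps) -> Nq x)
  (d : measure_display) (T : measurableType d) (P : probability T R)
  (X : nat -> T -> step V)
  (X_meas : forall (n : nat) (h : nat -> step V),
     measurable [set t | forall k, (k < n)%N -> X k t = h k])
  (X_law : forall (n : nat) (h : nat -> step V),
     P [set t | forall k, (k < n)%N -> X k t = h k] =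
     (\prod_(k < n) step_prob pW (Vproc adj a v0 h k) (h k))%:E) :
  exists A : set T, [/\ measurable A, (0 < P A)%E &
    forall t, A t ->
      (exists x : V -> V -> R,
         [/\ Nq x, stable_eq adj a pW v0 x, (forall i j, Gx x i j = g i j)
           & forall i j, (fun n => xproc adj a v0 (fun k => X k t) n i j) @ \oo --> x i j])
      /\ (forall i j,
            (fun n => Vproc adj a v0 (fun k => X k t) n i j) @ \oo --> +oo <-> g i j)].
Proof.
have [[q_sym q_ge0 _ _ _] Gq [N [HN HNq]]] := Hq.
have [P1 P2 P3] := HPG.
have g_irr : irreflexive g.
  by move=> i; apply/negP => /g_sub; rewrite adj_irr.
have [g_bip g_leaf] := nuclei_star g_sym g_irr HN.
pose A := apN adj a pW g.
have g_ap c l : c \in N -> g c l -> ap adj a pW c l = A c.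
  move=> _ cl; rewrite /A /apN; case: pickP => [k ck|/(_ l)]; last by rewrite cl.
  by have [_] := P1 c l c k cl ck (connect0 _ _).
have ap_pos_g i j : g i j -> 0 < ap adj a pW i j.
  by move=> ij; have [] := P1 i j i j ij ij (connect0 _ _).
have ap_cover i j : 0 < ap adj a pW i j -> exists k, g i k.
  move=> apij; apply/P3; exists j; split=> //.
  by move: apij; rewrite /ap /pij; case: ifP => //; rewrite mulr0 ltxx.
have A_isolated c : (forall l, ~~ g c l) -> A c = 0.
  by move=> nc; rewrite /A /apN; case: pickP => // k ck; rewrite (negPf (nc k)) in ck.
have A_ge0 c : 0 <= A c.
  by rewrite /A /apN; case: pickP => // k /ap_pos_g/ltW.
have A_sum : 0 < \sum_(c in N) A c.
  have [i [j apij]] := ap_pos; have [k ik] := ap_cover i j apij.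
  have [c [l [cN cl]]] : exists c l, c \in N /\ g c l.
    have [iN|iN] := boolP (i \in N); first by exists i, k.
    by exists k, i; rewrite g_sym -[k \in N]negbK -(g_bip i k ik).
  rewrite (bigD1 c) //= ltr_pwDl ?sumr_ge0 //.
  by rewrite -(g_ap c l cN cl) ap_pos_g.
have q_off i j : ~~ g i j -> q i j = 0.
  by rewrite -Gq /Gx -leNgt => qle; apply/eqP; rewrite eq_le qle q_ge0.
have q_gt0 i j : g i j -> 0 < q i j by rewrite -Gq.
pose H0 := 2 * \sum_(c in N) A c.
have H00 : 0 < H0 by rewrite mulr_gt0.
have xvq c : c \in N -> xv q c = A c / H0 by move=> cN; have [] := HNq c cN.
have xvq_gt0 i j : g i j -> 0 < xv q i by exact: xv_gt0.
(* The totals of the nuclei are prescribed on Gamma_G, so only the shares have to be aimed at those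
   of q. *)
pose z i j := q i j / xv q i.
have z_gt0 c l : c \in N -> g c l -> 0 < z c l.
  by move=> cN cl; rewrite divr_gt0 ?q_gt0 ?(xvq_gt0 c l).
have z_sum c l : c \in N -> g c l -> \sum_(k | g c k) z c k = 1.
  move=> cN cl; rewrite -mulr_suml; have [_ _ ->] := HNq c cN.
  by rewrite divff // gt_eqF ?(xvq_gt0 c l).
have [e e0 He] := Nq_nbhd.
have [ep [ka [n0 [k0 [B [[ep0 epe ka0 k00] epz mB PB HB]]]]]] :=
  confinement adj_irr adj_sym a_ge0 a_sym pW_ge0 pW_sum v0_sym v0_ge0 v0_pos g_sym g_sub
    g_bip g_leaf g_ap ap_pos_g ap_cover X_meas X_law z_gt0 z_sum e0.
exists B; split=> // t /HB[hok HPhi].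
have [y [x [[x_sym x_off] xy xvx x_sum [xlim Vlim]]]] :=
  limit_state adj_sym a_ge0 a_sym pW_ge0 v0_sym v0_ge0 v0_pos g_sym g_sub
    g_bip g_ap ap_pos_g ep0 epz ka0 k00 HPhi hok A_isolated A_sum.
split=> //; exists x.
have x_gt0N c l : c \in N -> g c l -> 0 < x c l.
  move=> cN cl; have [-> y0 _] := xy c l cN cl.
  by rewrite divr_gt0 // mulr_gt0 // -(g_ap c l cN cl) ap_pos_g.
have x_gt0 i j : g i j -> 0 < x i j.
  move=> ij; have [iN|iN] := boolP (i \in N); first exact: x_gt0N.
  by rewrite x_sym x_gt0N // 1?g_sym // -[j \in N]negbK -(g_bip i j ij).
have x_eq c l : c \in N -> g c l -> A c / xv x c = H0.
  move=> cN cl; have A0 : A c != 0 by rewrite gt_eqF // -(g_ap c l cN cl) ap_pos_g.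
  by rewrite (xvx c l cN cl) invf_div mulrC divfK.
have GxE i j : Gx x i j = g i j.
  by rewrite /Gx; have [/x_gt0|/x_off ->] := boolP (g i j); rewrite ?ltxx.
have xclose c l : c \in N -> g c l -> `|x c l - q c l| < e.
  move=> cN cl; have [xE _ yz] := xy c l cN cl.
  have qz : q c l = z c l * (A c / H0).
    by rewrite -xvq // /z divfK // gt_eqF ?(xvq_gt0 c l).
  (* x - q is (y - z) A c / H0; the factor 1/2 turns the bound |y - z| <= e into the strict
     inequality required. *)
  have AH : A c / H0 <= 1 / 2.
    rewrite ler_pdivrMr // /H0 mulrA divfK // mul1r (bigD1 c) //= lerDl.
    exact: sumr_ge0.
  rewrite xE -mulrA -/H0 qz -mulrBl normrM [`|A c / H0|]ger0_norm ?divr_ge0 ?(ltW H00) //.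
  apply: (@le_lt_trans _ _ (e * (1 / 2))); last first.
    by rewrite mul1r ltr_pdivrMr // ltr_pMr // ltr1n.
  by apply: ler_pM => //; [rewrite divr_ge0 // ltW|exact: le_trans yz epe].
have xG : in_Gamma_G adj a pW v0 g x.
  split=> //; first exact: (equilibrium_in_Delta v0_ge0 g_sub ap_pos_g x_sym x_off x_gt0 x_sum).
  exists N; split=> // i iN; split=> //.
  - have [/existsP[l il]|/existsPn ni] := boolP [exists l, g i l]; first exact: xvx il.
    by rewrite -/(A i) A_isolated // mul0r /xv big1 // => j _; rewrite x_off.
  - move=> j; exact: x_gt0.
  - rewrite /xv [RHS](bigID (g i)) /= [X in _ + X]big1 ?addr0 // => j; exact: x_off.
split=> //; last exact: (equilibrium_stable adj_irr adj_sym a_ge0 a_sym pW_ge0 v0_ge0 g_sym g_sub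
  g_bip g_leaf g_ap ap_pos_g ap_cover x_sym x_off x_gt0 x_sum A_isolated x_eq).
apply: He => // i j; have [ij|nij] := boolP (g i j); last first.
  by rewrite x_off // q_off // subrr normr0.
have [iN|iN] := boolP (i \in N); first exact: xclose.
by rewrite x_sym q_sym xclose // 1?g_sym // -[j \in N]negbK -(g_bip i j ij).
Qed.
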